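(* There is no connected nontrivial Ricci soliton $(M,\xi,\lambda,g)$ of dimension $n>2$ whose potential vector field $\xi$ is affine conformal Killing but not affine Killing.
   Context: $(M,g)$ is a Riemannian manifold with Levi-Civita connection $\nabla$. $(M,\xi,\lambda,g)$ is a Ricci soliton if $\lambda$ is a real constant and $\frac12\mathcal L_{\xi}g+\operatorname{Ric}=\lambda g$; it is trivial if its potential vector field $\xi$ is Killing, i.e. $\mathcal L_\xi g=0$, and nontrivial otherwise. A vector field $\xi$ is affine Killing if $\mathcal L_\xi\nabla=0$, and affine conformal Killing if there is a smooth function $\rho$ on $M$ with $(\mathcal L_{\xi}\nabla)(X,Y)=X(\rho)Y+Y(\rho)X-g(X,Y)\nabla\rho$ for all vector fields $X,Y$, where $\nabla\rho$ is the gradient of $\rho$. *)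

(* Defs.v *)
From mathcomp Require Import all_boot all_order all_algebra.
From mathcomp Require Import all_classical all_reals all_analysis.

Set Implicit Arguments.
Unset Strict Implicit.
Unset Printing Implicit Defensive.

Import Order.TTheory GRing.Theory Num.Theory.
Import numFieldNormedType.Exports.

Local Open Scope classical_set_scope.
Local Open Scope ring_scope.

(* A manifold is a space with a smooth atlas.  Global objects (functions,
   vector fields, metrics) are families of local expressions on the chart
   images U_i in R^n, related by the transition maps; the values of a local
   expression outside U_i are irrelevant. *)

Section Smooth.
Variables (R : realType) (n : nat) (W : normedModType R).

Definition iter_partial (s : seq 'I_n) (f : 'rV[R]_n -> W) : 'rV[R]_n -> W :=
  foldr (fun i h x => 'D_(delta_mx 0 i) h x) f s.

(* C^infinity, meant for open U. *)
Definition smooth_on (U : set 'rV[R]_n) (f : 'rV[R]_n -> W) : Prop :=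
  forall (s : seq 'I_n) (x : 'rV[R]_n), U x -> differentiable (iter_partial s f) x.

End Smooth.

Section Manifold.
Variables (R : realType) (n : nat).

(* [chart_inv] is the inverse of [chart_map] on the image of the domain. *)
Record chart (M : topologicalType) := Chart {
  chart_dom : set M;
  chart_map : M -> 'rV[R]_n;
  chart_inv : 'rV[R]_n -> M;
  chart_dom_open : open chart_dom;
  chart_img_open : open (chart_map @` chart_dom);
  chart_mapK : forall p, chart_dom p -> chart_inv (chart_map p) = p;
  chart_map_continuous : {within chart_dom, continuous chart_map};
  chart_inv_continuous :
    {within chart_map @` chart_dom, continuous chart_inv} }.

Definition overlap (M : topologicalType) (c d : chart M) : set 'rV[R]_n :=
  chart_map c @` (chart_dom c `&` chart_dom d).

Definition transition (M : topologicalType) (c d : chart M) :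
    'rV[R]_n -> 'rV[R]_n :=
  chart_map d \o chart_inv c.

Record smooth_manifold := SmoothManifold {
  carrier :> topologicalType;
  carrier_hausdorff : hausdorff_space carrier;
  carrier_second_countable : @second_countable carrier;
  atlas_index : Type;
  atlas : atlas_index -> chart carrier;
  atlas_cover : forall p : carrier, exists i, chart_dom (atlas i) p;
  atlas_compatible : forall i j,
    smooth_on (overlap (atlas i) (atlas j)) (transition (atlas i) (atlas j)) }.

Variable M : smooth_manifold.

Definition chart_image (i : atlas_index M) : set 'rV[R]_n :=
  chart_map (atlas i) @` chart_dom (atlas i).

Definition local_expr (f : M -> R) (i : atlas_index M) : 'rV[R]_n -> R :=
  f \o chart_inv (atlas i).

Definition smooth_function (f : M -> R) : Prop :=
  forall i, smooth_on (chart_image i) (local_expr f i).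

Record vector_field := VectorField {
  vf_comp :> atlas_index M -> 'rV[R]_n -> 'rV[R]_n;
  vf_smooth : forall i, smooth_on (chart_image i) (vf_comp i);
  vf_change : forall i j x, overlap (atlas i) (atlas j) x ->
    let tau := transition (atlas i) (atlas j) in
    vf_comp j (tau x) = 'd tau x (vf_comp i x) }.

Definition bilin (G : 'M[R]_n) (u v : 'rV[R]_n) : R := (u *m G *m v^T) 0 0.

Record riemannian_metric := RiemannianMetric {
  gram :> atlas_index M -> 'rV[R]_n -> 'M[R]_n;
  gram_smooth : forall i, smooth_on (chart_image i) (gram i);
  gram_sym : forall i x, chart_image i x -> (gram i x)^T = gram i x;
  gram_posdef : forall i x, chart_image i x ->
    forall u, u != 0 -> 0 < bilin (gram i x) u u;
  gram_change : forall i j x, overlap (atlas i) (atlas j) x ->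
    let tau := transition (atlas i) (atlas j) in
    forall u v, bilin (gram i x) u v =
                bilin (gram j (tau x)) ('d tau x u) ('d tau x v) }.

End Manifold.

(* Local expressions in one chart; [G] is the Gram matrix of the metric there,
   and a vector field acts on functions by X(f)(x) = 'D_(X x) f x. *)
Section LocalGeometry.
Variables (R : realType) (n : nat).
Local Notation V := 'rV[R]_n.
Variable G : V -> 'M[R]_n.
Implicit Types (X Y Z xi : V -> V) (f : V -> R).

Definition inner X Y : V -> R := fun x => bilin (G x) (X x) (Y x).

Definition bracket X Y : V -> V := fun x => 'D_(X x) Y x - 'D_(Y x) X x.

(* Partial derivative d_k g_ij. *)
Definition dgram (k i j : 'I_n) (x : V) : R :=
  'D_(delta_mx 0 k) (fun y => G y i j) x.

(* Gamma^k_ij, from the Koszul formula on coordinate fields. *)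
Definition christoffel (k i j : 'I_n) (x : V) : R :=
  2^-1 * \sum_l invmx (G x) k l * (dgram i j l x + dgram j i l x - dgram l i j x).

Definition levi_civita X Y : V -> V := fun x =>
  'D_(X x) Y x +
  \row_k \sum_i \sum_j christoffel k i j x * X x 0 i * Y x 0 j.

Definition riemann X Y Z : V -> V := fun x =>
  levi_civita X (levi_civita Y Z) x - levi_civita Y (levi_civita X Z) x
  - levi_civita (bracket X Y) Z x.

(* Ric(Y, Z) is the trace of u |-> R(u, Y)Z; R is tensorial, so a tangent
   vector u may be extended by a constant field. *)
Definition ricci Y Z : V -> R := fun x =>
  \tr (lin1_mx (fun u : V => riemann (fun=> u) Y Z x)).

Definition gradient f : V -> V := fun x =>
  (\row_i 'D_(delta_mx 0 i) f x) *m invmx (G x).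

(* (L_xi g)(X, Y) *)
Definition lie_metric xi X Y : V -> R := fun x =>
  'D_(xi x) (inner X Y) x - inner (bracket xi X) Y x - inner X (bracket xi Y) x.

(* (L_xi nabla)(X, Y) *)
Definition lie_connection xi X Y : V -> V := fun x =>
  bracket xi (levi_civita X Y) x - levi_civita (bracket xi X) Y x
  - levi_civita X (bracket xi Y) x.

End LocalGeometry.

Section Solitons.
Variables (R : realType) (n : nat) (M : smooth_manifold R n).
Variables (g : riemannian_metric M) (xi : vector_field M).

Definition ricci_soliton (lambda : R) : Prop :=
  forall (X Y : vector_field M) i x, chart_image i x ->
    2^-1 * lie_metric (g i) (xi i) (X i) (Y i) x + ricci (g i) (X i) (Y i) x
    = lambda * inner (g i) (X i) (Y i) x.

Definition killing : Prop :=
  forall (X Y : vector_field M) i x, chart_image i x ->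
    lie_metric (g i) (xi i) (X i) (Y i) x = 0.

Definition nontrivial_soliton (lambda : R) : Prop :=
  ricci_soliton lambda /\ ~ killing.

Definition affine_killing : Prop :=
  forall (X Y : vector_field M) i x, chart_image i x ->
    lie_connection (g i) (xi i) (X i) (Y i) x = 0.

Definition affine_conformal_killing : Prop :=
  exists2 rho : M -> R, smooth_function rho &
  forall (X Y : vector_field M) i x, chart_image i x ->
    let r := local_expr rho i in
    lie_connection (g i) (xi i) (X i) (Y i) x =
      'D_(X i x) r x *: Y i x + 'D_(Y i x) r x *: X i x
      - inner (g i) (X i) (Y i) x *: gradient (g i) r x.

End Solitons.

(* Main.v *)
Require Import Defs.
From mathcomp Require Import all_boot all_order all_algebra.
From mathcomp Require Import all_classical all_reals all_analysis.
From mathcomp Require Import ring lra.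

Set Implicit Arguments.
Unset Strict Implicit.
Unset Printing Implicit Defensive.

Import Order.TTheory GRing.Theory Num.Theory.
Import numFieldNormedType.Exports.

Local Open Scope classical_set_scope.
Local Open Scope ring_scope.

(** Let rho be the conformal function of xi.  The metric is parallel, so the
    covariant derivative of L_xi g is the symmetrization of L_xi nabla
    ([nabla_lie_gram]); for an affine conformal Killing field this symmetrization
    is 2 d rho (x) g ([nabla_lie_gram_conformal]).  The soliton equation expresses
    Ric as lambda g - (1/2) L_xi g, hence nabla Ric = - d rho (x) g
    ([nabla_soliton_ric]).  Taking traces, d scal = - n d rho and
    div Ric = - d rho, and the contracted second Bianchi identity
    d scal = 2 div Ric yields (n - 2) d rho = 0 ([contracted_bianchi]).  So d rho
    vanishes for n > 2, hence L_xi nabla = 0 and xi is affine Killing.  The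
    argument is local, and is carried out in a chart.

    At a point, it is an identity between matrices: the connection, its first two
    partial derivatives and the Gram matrix are treated as independent data
    subject to the relations that nabla g = 0, the absence of torsion and the
    symmetry of second partial derivatives impose.  These relations are derived
    from the Koszul formula and from [partial_swap], whose proof uses the mean
    value theorem; the inverse Gram matrix is smooth by Cramer's rule.

    The hypotheses speak of global vector fields only.  To read them in the frame
    of coordinate fields near a point, [extend_constant] multiplies a coordinate
    field by a bump function and extends it by 0; this agrees with the coordinate
    field near the point, and the operators involved are local. *)

(** * Differentials depend only on germs *)

Section Germs.
Variables (R : realType) (V W : normedModType R).

Lemma near_eq_differentiable (f g : V -> W) x :
  (\forall y \near x, f y = g y) -> differentiable f x -> differentiable g x.
Proof.
move=> fg df; have eqg : g \o shift x = cst (g x) + 'd f x +o_ 0 id.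
  apply/eqaddoP => _/posnumP[e].
  have /eqaddoP/(_ e%:num (gt0 e)) := diff_locally df.
  have fgx : f x = g x by apply: nbhs_singleton fg.
  move: (fg); rewrite (near_shift 0 x) subr0 => fg0.
  by apply: filterS2 fg0 => y /= E; rewrite !fctE /= E fgx.
apply/diff_locallyP; rewrite (diff_unique (diff_continuous df) eqg).
by split; first exact: diff_continuous.
Qed.

Lemma near_eq_diff (f g : V -> W) x :
  (\forall y \near x, f y = g y) -> differentiable f x ->
  'd f x = 'd g x :> (V -> W).
Proof.
move=> fg df; apply/funext => v; have dg := near_eq_differentiable fg df.
by rewrite -!deriveE//; exact: near_eq_derive.
Qed.

End Germs.

(** * Partial derivatives and functions of class C^k *)

Section Partial.
Variables (R : realType) (n : nat).
Local Notation V := 'rV[R]_n.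

Definition partial (W : normedModType R) (i : 'I_n) (f : V -> W) : V -> W :=
  fun x => 'D_(delta_mx 0 i) f x.

Lemma partialE (W : normedModType R) (f : V -> W) i x :
  differentiable f x -> partial i f x = 'd f x (delta_mx 0 i).
Proof. exact: deriveE. Qed.

Lemma diff_partial (W : normedModType R) (f : V -> W) x v :
  differentiable f x -> 'd f x v = \sum_a v 0 a *: partial a f x.
Proof.
move=> df; rewrite {1}[v]row_sum_delta linear_sum/=; apply: eq_bigr => a _.
by rewrite linearZ/= partialE.
Qed.

Lemma derive_partial (W : normedModType R) (f : V -> W) x v :
  differentiable f x -> 'D_v f x = \sum_a v 0 a *: partial a f x.
Proof. by move=> df; rewrite deriveE// diff_partial. Qed.

Lemma near_eq_partial (W : normedModType R) (f g : V -> W) i x :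
  (\forall y \near x, f y = g y) -> partial i f x = partial i g x.
Proof. exact: near_eq_derive. Qed.

Lemma open_eq_partial (W : normedModType R) (U : set V) (f g : V -> W) i x :
  open U -> (forall y, U y -> f y = g y) -> U x ->
  partial i f x = partial i g x.
Proof.
move=> oU fg Ux; apply: near_eq_partial.
by apply: filterS (open_nbhs_nbhs (conj oU Ux)) => y /fg.
Qed.

Lemma differentiable_mxP p q (f : V -> 'M[R]_(p, q)) x :
  differentiable f x <-> forall i j, differentiable (fun y => f y i j) x.
Proof.
split=> [df i j|df].
  by apply: (@differentiable_comp _ _ _ _ f (fun M : 'M[R]_(p, q) => M i j));
    last exact: differentiable_coord.
pose F i j : V -> 'M[R]_(p, q) := fun y => f y i j *: delta_mx i j.
have -> : f = \sum_i \sum_j F i j.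
  apply/funext => y; rewrite fct_sumE [LHS]matrix_sum_delta.
  by apply: eq_bigr => i _; rewrite fct_sumE.
apply: differentiable_sum => i; apply: differentiable_sum => j.
exact: differentiableZl.
Qed.

Lemma partial_mx p q (f : V -> 'M[R]_(p, q)) a x i j :
  differentiable f x -> partial a f x i j = partial a (fun y => f y i j) x.
Proof.
by move=> df; rewrite /partial derive_mx ?mxE//; exact: diff_derivable.
Qed.

Lemma partialD (W : normedModType R) (f g : V -> W) i x : differentiable f x -> differentiable g x ->
  partial i (fun y => f y + g y) x = partial i f x + partial i g x.
Proof. by move=> df dg; rewrite /partial deriveD//; exact: diff_derivable. Qed.

Lemma partialM (f g : V -> R) i x : differentiable f x -> differentiable g x ->
  partial i (fun y => f y * g y) x = partial i f x * g x + f x * partial i g x.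
Proof.
move=> df dg; rewrite /partial deriveM; try exact: diff_derivable.
by rewrite addrC; congr (_ + _); exact: mulrC.
Qed.

Lemma partial_cst (W : normedModType R) (c : W) i x : partial i (fun=> c) x = 0.
Proof. exact: derive_cst. Qed.

Lemma partialV (f : V -> R) i x : differentiable f x -> f x != 0 ->
  partial i (fun y => (f y)^-1) x = - (partial i f x * ((f x)^-1 * (f x)^-1)).
Proof.
move=> df f0; rewrite /partial deriveV//; last exact: diff_derivable.
by rewrite expr2 invfM scaleNr; congr (- _); exact: mulrC.
Qed.

Lemma partial_comp m (W : normedModType R) (f : 'rV[R]_n -> W)
    (tau : 'rV[R]_m -> V) (i : 'I_m) x :
  differentiable tau x -> differentiable f (tau x) ->
  'D_(delta_mx 0 i) (f \o tau) x =
  \sum_a ('D_(delta_mx 0 i) tau x) 0 a *: partial a f (tau x).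
Proof.
move=> dt df; rewrite deriveE; last exact: differentiable_comp.
by rewrite diff_comp//= diff_partial//; apply: eq_bigr => a _; rewrite deriveE.
Qed.

End Partial.

Section Ck.
Variables (R : realType) (n : nat).
Local Notation V := 'rV[R]_n.

(** Class C^k, with one more derivative than usual: the partial derivatives of
    order k are required to be differentiable, not merely continuous.  Stability
    under products, inverses and composites goes by induction on k, because the
    derivative of each of these is built from the same operations; quantifying
    over k then gives smoothness. *)
Fixpoint Ck (W : normedModType R) (k : nat) (U : set V) (f : V -> W) : Prop :=
  (forall x, U x -> differentiable f x) /\
  if k is k'.+1 then forall i, Ck k' U (partial i f) else True.

Section Gen.
Variable W : normedModType R.
Implicit Types (f g : V -> W) (U : set V).

Lemma Ck_differentiable k U f x : Ck k U f -> U x -> differentiable f x.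
Proof. by case: k => [|k] [+ _]; apply. Qed.

Lemma Ck_partial k U f i : Ck k.+1 U f -> Ck k U (partial i f).
Proof. by case=> _; apply. Qed.

Lemma CkW k U f : Ck k.+1 U f -> Ck k U f.
Proof.
elim: k f => [|k IH] f [df Hf]; split=> // i.
exact/IH/Hf.
Qed.

Lemma eq_Ck k U f g : open U -> (forall x, U x -> f x = g x) ->
  Ck k U f -> Ck k U g.
Proof.
move=> oU; have E f' g' : (forall x, U x -> f' x = g' x) -> forall x, U x ->
    \forall y \near x, f' y = g' y.
  by move=> fg x Ux; apply: filterS (open_nbhs_nbhs (conj oU Ux)) => y /fg.
elim: k f g => [|k IH] f g fg [df Hf]; split=> //.
- by move=> x Ux; apply: (near_eq_differentiable (E _ _ fg x Ux)); exact: df.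
- by move=> x Ux; apply: (near_eq_differentiable (E _ _ fg x Ux)); exact: df.
- by move=> i; apply: IH (Hf i) => x Ux; exact: near_eq_partial (E _ _ fg x Ux).
Qed.

(** Smoothness is a pointwise condition on germs, so it may be tested on an
    arbitrary cover; this allows a function given by cases to be treated on each
    piece separately. *)
Lemma Ck_local k U f : (forall x, U x -> exists2 U', U' x & Ck k U' f) ->
  Ck k U f.
Proof.
elim: k f => [|k IH] f H; split=> //.
- by move=> x /H[U' U'x /Ck_differentiable]; apply.
- by move=> x /H[U' U'x /Ck_differentiable]; apply.
- by move=> i; apply: IH => x /H[U' U'x Hf]; exists U' => //; exact: Ck_partial.
Qed.

Lemma smooth_onP U f : smooth_on U f <-> forall k, Ck k U f.
Proof.
split=> [+ k|].
  elim: k f => [|k IH] f sf; split=> //.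
  - exact: (sf [::]).
  - exact: (sf [::]).
  - by move=> i; apply: IH => s x; have := sf (rcons s i) x;
      rewrite /iter_partial foldr_rcons.
move=> + s; elim/last_ind: s f => [|s i IH] f Hf.
  by move=> x; exact: Ck_differentiable (Hf 0%N).
rewrite /iter_partial foldr_rcons; apply: IH => k.
exact: Ck_partial (Hf k.+1).
Qed.

Lemma Ck_cst k U (c : W) : Ck k U (fun=> c).
Proof.
elim: k c => [|k IH] c; split=> // i.
have -> : partial i (fun=> c) = fun=> 0; last exact: IH.
by apply/funext => x; exact: derive_cst.
Qed.

End Gen.

(** Reduces vector- and matrix-valued functions to scalar ones, where the
    algebraic closure properties are proved. *)
Lemma Ck_mxP p q k (U : set V) (f : V -> 'M[R]_(p, q)) : open U ->
  Ck k U f <-> forall i j, Ck k U (fun x => f x i j).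
Proof.
move=> oU; split.
  move=> Cf i j; elim: k f Cf => [|k IH] f [df Cf]; split=> //.
  - by move=> x /df/differentiable_mxP.
  - by move=> x /df/differentiable_mxP.
  - move=> a; apply: eq_Ck (IH _ (Cf a)) => // x Ux.
    by rewrite partial_mx//; exact: df.
move=> Cf; elim: k f Cf => [|k IH] f Cf; split=> //.
- by move=> x Ux; apply/differentiable_mxP => i j; apply: Ck_differentiable (Cf i j) Ux.
- by move=> x Ux; apply/differentiable_mxP => i j; apply: Ck_differentiable (Cf i j) Ux.
- move=> a; apply: IH => i j; apply: eq_Ck (Ck_partial a (Cf i j)) => // x Ux.
  rewrite partial_mx//; apply/differentiable_mxP => i' j'.
  exact: Ck_differentiable (Cf i' j') Ux.
Qed.

Section Scalar.
Variables (U : set V) (oU : open U).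
Implicit Types f g : V -> R.

Lemma CkD k f g : Ck k U f -> Ck k U g -> Ck k U (fun x => f x + g x).
Proof.
elim: k f g => [|k IH] f g Cf Cg; split=> //.
- by move=> x Ux; apply: differentiableD;
    [exact: Ck_differentiable Cf Ux|exact: Ck_differentiable Cg Ux].
- by move=> x Ux; apply: differentiableD;
    [exact: Ck_differentiable Cf Ux|exact: Ck_differentiable Cg Ux].
- move=> i; have := IH _ _ (Ck_partial i Cf) (Ck_partial i Cg).
  apply: eq_Ck => // x Ux.
  by rewrite partialD//;
    [exact: (Ck_differentiable Cf Ux)|exact: (Ck_differentiable Cg Ux)].
Qed.

Lemma CkM k f g : Ck k U f -> Ck k U g -> Ck k U (fun x => f x * g x).
Proof.
elim: k f g => [|k IH] f g Cf Cg; split=> //.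
- by move=> x Ux; apply: differentiableM;
    [exact: Ck_differentiable Cf Ux|exact: Ck_differentiable Cg Ux].
- by move=> x Ux; apply: differentiableM;
    [exact: Ck_differentiable Cf Ux|exact: Ck_differentiable Cg Ux].
- move=> i; have := CkD (IH _ _ (Ck_partial i Cf) (CkW Cg))
                        (IH _ _ (CkW Cf) (Ck_partial i Cg)).
  apply: eq_Ck => // x Ux.
  by rewrite partialM//;
    [exact: (Ck_differentiable Cf Ux)|exact: (Ck_differentiable Cg Ux)].
Qed.

Lemma CkN k f : Ck k U f -> Ck k U (fun x => - f x).
Proof.
move=> Cf; have := CkM (Ck_cst k U (-1 : R)) Cf.
by apply: eq_Ck => // x _; rewrite mulN1r.
Qed.

Lemma CkB k f g : Ck k U f -> Ck k U g -> Ck k U (fun x => f x - g x).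
Proof. by move=> Cf Cg; apply: CkD => //; exact: CkN. Qed.

Lemma Ck_sum I (r : seq I) (P : pred I) k (f : I -> V -> R) :
  (forall i, Ck k U (f i)) -> Ck k U (fun x => \sum_(i <- r | P i) f i x).
Proof.
move=> Cf; elim: r => [|i r IH].
  by apply: eq_Ck (Ck_cst k U (0 : R)) => // x _; rewrite big_nil.
case Pi : (P i); last by apply: eq_Ck IH => // x _; rewrite big_cons Pi.
by apply: eq_Ck (CkD (Cf i) IH) => // x _; rewrite big_cons Pi.
Qed.

Lemma Ck_prod I (r : seq I) (P : pred I) k (f : I -> V -> R) :
  (forall i, Ck k U (f i)) -> Ck k U (fun x => \prod_(i <- r | P i) f i x).
Proof.
move=> Cf; elim: r => [|i r IH].
  by apply: eq_Ck (Ck_cst k U (1 : R)) => // x _; rewrite big_nil.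
case Pi : (P i); last by apply: eq_Ck IH => // x _; rewrite big_cons Pi.
by apply: eq_Ck (CkM (Cf i) IH) => // x _; rewrite big_cons Pi.
Qed.

Lemma CkV k f : (forall x, U x -> f x != 0) -> Ck k U f ->
  Ck k U (fun x => (f x)^-1).
Proof.
move=> f0; elim: k => [|k IH] Cf; split=> //.
- by move=> x Ux; apply: differentiableV (f0 x Ux); apply: Ck_differentiable Cf Ux.
- by move=> x Ux; apply: differentiableV (f0 x Ux); apply: Ck_differentiable Cf Ux.
- move=> i; have CV := IH (CkW Cf).
  apply: eq_Ck (CkN (CkM (Ck_partial i Cf) (CkM CV CV))) => // x Ux.
  by rewrite partialV ?f0//; apply: Ck_differentiable Cf Ux.
Qed.

Lemma Ck_comp k U' (f : V -> R) (tau : V -> V) :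
  (forall x, U x -> U' (tau x)) -> Ck k U tau -> Ck k U' f ->
  Ck k U (f \o tau).
Proof.
move=> UU'; elim: k f => [|k IH] f Ct Cf.
  split=> // x Ux; apply: differentiable_comp; first exact: (Ck_differentiable Ct Ux).
  exact: (Ck_differentiable Cf (UU' x Ux)).
split.
  move=> x Ux; apply: differentiable_comp; first exact: (Ck_differentiable Ct Ux).
  exact: (Ck_differentiable Cf (UU' x Ux)).
move=> i; have Cta a : Ck k U (fun x => partial i tau x 0 a).
  by have := Ck_partial i Ct; rewrite Ck_mxP//; exact.
have := Ck_sum (index_enum 'I_n) xpredT
  (fun a => CkM (Cta a) (IH _ (CkW Ct) (Ck_partial a Cf))).
apply: eq_Ck => // x Ux; rewrite [RHS]partial_comp//.
  exact: (Ck_differentiable Ct Ux).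
exact: (Ck_differentiable Cf (UU' x Ux)).
Qed.

Lemma Ck_det m k (G : V -> 'M[R]_m) : (forall i j, Ck k U (fun x => G x i j)) ->
  Ck k U (fun x => \det (G x)).
Proof.
move=> CG; apply: Ck_sum => s; apply: CkM; first exact: Ck_cst.
exact: Ck_prod.
Qed.

(** By Cramer's rule the entries of the inverse are quotients of determinants,
    which are polynomials in the entries. *)
Lemma Ck_invmx m k (G : V -> 'M[R]_m) : (forall x, U x -> G x \in unitmx) ->
  (forall i j, Ck k U (fun x => G x i j)) ->
  forall i j, Ck k U (fun x => invmx (G x) i j).
Proof.
move=> uG CG i j.
have Cd : Ck k U (fun x => (\det (G x))^-1).
  by apply: CkV; [move=> x /uG; rewrite unitmxE unitfE|exact: Ck_det].
have Cc : Ck k U (fun x => cofactor (G x) j i).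
  apply: CkM; first exact: Ck_cst.
  by apply: Ck_det => a b; apply: eq_Ck (CG (lift j a) (lift i b)) => // x _;
    rewrite !mxE.
apply: eq_Ck (CkM Cd Cc) => // x Ux.
by rewrite /invmx uG// !mxE.
Qed.

End Scalar.
End Ck.

(** * Symmetry of second partial derivatives *)

Section Schwarz.
Variables (R : realType) (n : nat).
Local Notation V := 'rV[R]_n.
Implicit Types (f g : V -> R) (x y u v : V).

Lemma is_derive_line g y v (s : R) : differentiable g (y + s *: v) ->
  is_derive s 1 (fun t => g (y + t *: v)) ('D_v g (y + s *: v)).
Proof.
move=> dg; have E : (fun h : R => h^-1 *:
    (((fun t => g (y + t *: v)) \o shift s) (h *: 1) - g (y + s *: v))) = (fun h => h^-1 *: ((g \o shift (y + s *: v)) (h *: v) - g (y + s *: v))).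
  apply/funext => h /=; congr (_ *: (g _ - _)).
  by rewrite [h *: 1]mulr1 scalerDl addrCA.
have := @diff_derivable _ _ _ _ _ v dg; rewrite /derivable -E => H.
by split=> //; rewrite /derive /= E.
Qed.

(** The mean value theorem applied twice, first along u to the increment of f
    along v, then along v.  The left-hand side is symmetric in u and v. *)
Lemma second_difference f x u v (h : R) : 0 < h ->
  (forall s t, 0 <= s <= h -> 0 <= t <= h ->
    differentiable f (x + s *: u + t *: v) /\
    differentiable ('D_u f) (x + s *: u + t *: v)) ->
  exists s t, [/\ 0 <= s <= h, 0 <= t <= h &
    f (x + h *: u + h *: v) - f (x + h *: u) - f (x + h *: v) + f x =
    'D_v ('D_u f) (x + s *: u + t *: v) * h * h].
Proof.
move=> h0 df; have hh : 0 <= h <= h by rewrite lexx ltW.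
have h00 : 0 <= (0 : R) <= h by rewrite lexx ltW.
pose phi s := f (x + s *: u + h *: v) - f (x + s *: u).
pose dphi s := 'D_u f (x + s *: u + h *: v) - 'D_u f (x + s *: u).
have dphiE s : 0 <= s <= h -> is_derive s (1 : R) phi (dphi s).
  move=> sh; apply: is_deriveB.
    have E t : x + t *: u + h *: v = (x + h *: v) + t *: u by rewrite addrAC.
    rewrite E (_ : (fun t => _) = (fun t => f ((x + h *: v) + t *: u))).
      by apply: is_derive_line; rewrite -E; case: (df s h).
    by apply/funext => t; rewrite E.
  by apply: is_derive_line; have [] := df s 0 sh h00; rewrite scale0r addr0.
have inoo a : a \in `]0, h[%R -> 0 <= a <= h.
  by rewrite in_itv/= => /andP[/ltW -> /ltW ->].
have cc (F dF : R -> R) :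
    (forall s, 0 <= s <= h -> is_derive s (1 : R) F (dF s)) ->
    {within `[0, h], continuous F}.
  move=> H; apply: derivable_within_continuous => s.
  by rewrite in_itv/= => /H[].
have [s /inoo sh E1] := @MVT _ phi dphi 0 h h0 (fun s H => dphiE s (inoo s H)) (cc _ _ dphiE).
pose psi t := 'D_u f (x + s *: u + t *: v).
have dpsi t : 0 <= t <= h ->
    is_derive t (1 : R) psi ('D_v ('D_u f) (x + s *: u + t *: v)).
  by move=> th; apply: is_derive_line; case: (df s t).
have [t /inoo th E2] := @MVT _ psi _ 0 h h0 (fun s H => dpsi s (inoo s H)) (cc _ _ dpsi).
exists s, t; split=> //.
move: E1 E2; rewrite /phi /psi /dphi !scale0r !addr0 !subr0 => E1 E2.
by rewrite -E2 -E1; lra.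
Qed.

Lemma near_and_close (P : set V) f g x (e : R) : nbhs x P ->
  {for x, continuous f} -> {for x, continuous g} -> 0 < e ->
  \forall y \near x, [/\ P y, `|f x - f y| < e & `|g x - g y| < e].
Proof.
move=> HP /cvgrPdist_lt Hf /cvgrPdist_lt Hg e0.
by near=> y; split; near: y; [|exact: Hf|exact: Hg].
Unshelve. all: by end_near. Qed.

(** The two mixed derivatives are compared through the common value that they
    take at two nearby points. *)
Lemma dist_via_common_value (a b p q e : R) : p = q -> `|b - p| < e / 2 ->
  `|a - q| < e / 2 -> `|a - b| <= e.
Proof.
move=> <- bp ap; rewrite [e]splitr ltW// -[X in `|X|](subrKA p).
by rewrite (le_lt_trans (ler_normD _ _))// ltrD// distrC.
Qed.

(** Schwarz's theorem: both mixed derivatives, taken at points close to x, are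
    equal to the same second difference divided by h^2; continuity at x lets
    these points tend to x. *)
Lemma partial_swap (U : set V) f i j x : open U -> Ck 2 U f -> U x ->
  partial i (partial j f) x = partial j (partial i f) x.
Proof.
move=> oU Cf Ux; set u : V := delta_mx 0 i; set v : V := delta_mx 0 j.
have Cp a b : differentiable (partial a (partial b f)) x.
  exact: (Ck_differentiable (Ck_partial a (Ck_partial b Cf)) Ux).
have cij := differentiable_continuous (Cp i j).
have cji := differentiable_continuous (Cp j i).
suff H (e : R) : 0 < e ->
    `|partial i (partial j f) x - partial j (partial i f) x| <= e.
  apply/eqP; rewrite -subr_eq0 -normr_le0; apply/ler_addgt0Pr => e e0.
  by rewrite add0r; exact: H.
move=> e0.
have e2 : 0 < e / 2 by rewrite divr_gt0.
have : \forall y \near x, [/\ U y,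
    `|partial i (partial j f) x - partial i (partial j f) y| < e / 2 &
    `|partial j (partial i f) x - partial j (partial i f) y| < e / 2].
  by have := near_and_close (open_nbhs_nbhs (conj oU Ux)) cij cji e2.
move=> /nbhs_ballP[d /= d0 Hd].
pose N := `|u| + `|v| + 1; have N0 : 0 < N by rewrite ltr_wpDl// addr_ge0.
pose h := d / 2 / N; have h0 : 0 < h by rewrite !divr_gt0.
have Hb s t : 0 <= s <= h -> 0 <= t <= h -> ball x d (x + s *: u + t *: v).
  move=> /andP[s0 sh] /andP[t0 th]; rewrite -ball_normE /ball_/= -addrA opprD addNKr.
  rewrite normrN (le_lt_trans (ler_normD _ _))// !normrZ !ger0_norm//.
  apply: (@le_lt_trans _ _ (h * N)); last first.
    by rewrite /h divfK ?gt_eqF// ltr_pdivrMr// ltr_pMr// ltrDl.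
  rewrite /N 2!mulrDr mulr1 -[leLHS]addr0 lerD ?(ltW h0)//.
  by rewrite lerD// ler_wpM2r.
have [s [t [sh th E1]]] : exists s t, [/\ 0 <= s <= h, 0 <= t <= h &
    f (x + h *: u + h *: v) - f (x + h *: u) - f (x + h *: v) + f x =
    'D_v ('D_u f) (x + s *: u + t *: v) * h * h].
  apply: second_difference => // s t sh th; have [Uy _ _] := Hd _ (Hb _ _ sh th).
  split; first exact: (Ck_differentiable Cf Uy).
  exact: (Ck_differentiable (Ck_partial i Cf) Uy).
have [t' [s' [th' sh' E2]]] : exists s t, [/\ 0 <= s <= h, 0 <= t <= h &
    f (x + h *: v + h *: u) - f (x + h *: v) - f (x + h *: u) + f x =
    'D_u ('D_v f) (x + s *: v + t *: u) * h * h].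
  apply: second_difference => // s1 t1 sh1 th1.
  rewrite addrAC; have [Uy _ _] := Hd _ (Hb _ _ th1 sh1).
  split; first exact: (Ck_differentiable Cf Uy).
  exact: (Ck_differentiable (Ck_partial j Cf) Uy).
have E : partial j (partial i f) (x + s *: u + t *: v) =
         partial i (partial j f) (x + s' *: u + t' *: v).
  have hn0 : h != 0 by rewrite gt_eqF.
  rewrite (addrAC x (h *: v)) (addrAC x (t' *: v)) in E2.
  have : 'D_v ('D_u f) (x + s *: u + t *: v) * h * h =
         'D_u ('D_v f) (x + s' *: u + t' *: v) * h * h.
    by apply: etrans (esym E1) _; apply: etrans _ E2; rewrite [in LHS](addrAC (f _)).
  by move=> /(mulIf hn0)/(mulIf hn0).
have [_ _ B1] := Hd _ (Hb _ _ sh th); have [_ B2 _] := Hd _ (Hb _ _ sh' th').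
exact: dist_via_common_value E B1 B2.
Qed.

End Schwarz.

(** * Algebra of a connection at a point: Bianchi identities *)

Section MatrixIdentities.
Variables (R : comUnitRingType) (p q : nat).
Local Notation M := 'M[R]_(p, q).

Lemma mx_entryD (X Y : M) a b : (X + Y) a b = X a b + Y a b.
Proof. by rewrite mxE. Qed.

Lemma mx_entryN (X : M) a b : (- X) a b = - X a b.
Proof. by rewrite mxE. Qed.

Lemma mx_entry0 a b : (0 : M) a b = 0.
Proof. by rewrite mxE. Qed.

Lemma mx_entryZ c (X : M) a b : (c *: X) a b = c * X a b.
Proof. by rewrite mxE. Qed.

Lemma row_entry (X : M) i j : row i X 0 j = X i j.
Proof. by rewrite mxE. Qed.

Definition mx_entryE := (mx_entryD, mx_entryN, mx_entry0, mx_entryZ).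

Lemma mx_trD (X Y : M) : (X + Y)^T = X^T + Y^T.
Proof. exact: linearD. Qed.

Lemma mx_trN (X : M) : (- X)^T = - X^T.
Proof. exact: linearN. Qed.

End MatrixIdentities.

(** Noncommutative polynomial identities between square matrices, with
    transposes: after distributing, each monomial has the same normal form on
    both sides, so entrywise the identity is linear in these monomials and a
    commutative ring tactic closes it. *)
Ltac mx_ring := rewrite /= ?(mulmxDl, mulmxDr, mulNmx, mulmxN, mx_trD, mx_trN,
    trmx_mul, trmxK, mulmxA) /=; apply/matrixP => ? ?;
  rewrite ?mx_entryE;
  ring.

Section Bianchi.
Variables (R : comUnitRingType) (n : nat).
Local Notation M := 'M[R]_n.

Lemma mx_skew_sum I (r : seq I) (c : I -> R) (X : I -> M) (G : M) :
  (forall i, X i *m G + G *m (X i)^T = 0) ->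
  (\sum_(i <- r) c i *: X i) *m G + G *m (\sum_(i <- r) c i *: X i)^T = 0.
Proof.
move=> H; rewrite mulmx_suml linear_sum mulmx_sumr -big_split/= big1// => i _.
by rewrite linearZ/= -scalemxAl -scalemxAr -scalerDr H scaler0.
Qed.

(** [A i] is the matrix of the connection in the direction e_i acting on row
    vectors, nabla_i v = d_i v + v A_i, whence the order of the products in
    [curv]; [A1 k i] and [A2 l k i] stand for d_k A_i and d_l d_k A_i at the
    point.  Row l of [curv i j] is R(e_i, e_j) e_l. *)
Variables (A : 'I_n -> M) (A1 : 'I_n -> 'I_n -> M).
Variable (A2 : 'I_n -> 'I_n -> 'I_n -> M).

Definition curv i j : M := A1 i j - A1 j i + A j *m A i - A i *m A j.

(** The derivative d_k of [curv i j] by the Leibniz rule. *)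
Definition dcurv k i j : M := A2 k i j - A2 k j i
  + (A1 k j *m A i + A j *m A1 k i) - (A1 k i *m A j + A i *m A1 k j).

(** The covariant derivative of the curvature in its endomorphism indices only;
    [nabla_curv] adds the corrections for the two form indices, the second of
    which changes sign because the curvature matrix is skew in these indices. *)
Definition nabla_end k i j : M :=
  dcurv k i j + curv i j *m A k - A k *m curv i j.

Definition conn_contract k i j : M := \sum_p A k i p *: curv p j.

Definition nabla_curv k i j : M :=
  nabla_end k i j - conn_contract k i j + conn_contract k j i.

Definition ric j l : R := \sum_i curv i j l i.
Definition dric k j l : R := \sum_i dcurv k i j l i.
Definition nabla_ric k j l : R :=
  dric k j l - \sum_p A k j p * ric p l - \sum_p A k l p * ric j p.

Lemma curvC i j : curv j i = - curv i j.
Proof. rewrite /curv; mx_ring. Qed.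

Lemma nabla_curvC k i j : nabla_curv k j i = - nabla_curv k i j.
Proof.
have dC : dcurv k j i = - dcurv k i j by rewrite /dcurv; mx_ring.
rewrite /nabla_curv /nabla_end dC (curvC i j); mx_ring.
Qed.

(** Contraction commutes with covariant differentiation: the two Christoffel
    terms attached to the contracted pair of indices cancel. *)
Lemma trace_nabla_curv k j l : \sum_i nabla_curv k i j l i = nabla_ric k j l.
Proof.
have E i : nabla_curv k i j l i = dcurv k i j l i
    + \sum_p curv i j l p * A k p i - \sum_p A k l p * curv i j p i
    - \sum_p A k i p * curv p j l i - \sum_p A k j p * curv i p l i.
  rewrite /nabla_curv /nabla_end /conn_contract !mx_entryE !summxE.
  rewrite [(curv i j *m _) l i]mxE [(A k *m curv _ _) l i]mxE.
  congr (_ - _ + _); first by apply: eq_bigr => p _; rewrite mx_entryZ.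
  by rewrite -sumrN; apply: eq_bigr => p _; rewrite mx_entryZ curvC mx_entryN mulrN.
under eq_bigr do rewrite E.
rewrite !(big_split, sumrN)/= -/(dric k j l) /nabla_ric.
have -> : \sum_i \sum_p curv i j l p * A k p i =
          \sum_i \sum_p A k i p * curv p j l i.
  rewrite exchange_big/=; apply: eq_bigr => p _; apply: eq_bigr => i _.
  exact: mulrC.
have -> : \sum_i \sum_p A k l p * curv i j p i = \sum_p A k l p * ric j p.
  by rewrite exchange_big; apply: eq_bigr => p _; rewrite mulr_sumr.
have -> : \sum_i \sum_p A k j p * curv i p l i = \sum_p A k j p * ric p l.
  by rewrite exchange_big; apply: eq_bigr => p _; rewrite mulr_sumr.
ring.
Qed.

Hypothesis A2C : forall k i j, A2 k i j = A2 i k j.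
Hypothesis torsion_free : forall i j k, A i j k = A j i k.

(** The endomorphism part is a Jacobi identity, in which second derivatives of
    the connection cancel since they are symmetric; the corrections on the form
    indices cancel because the connection is torsion free. *)
Lemma second_bianchi k i j :
  nabla_curv k i j + nabla_curv i j k + nabla_curv j k i = 0.
Proof.
have cC a b c : conn_contract a b c = conn_contract b a c.
  by apply: eq_bigr => p _; rewrite torsion_free.
have : nabla_end k i j + nabla_end i j k + nabla_end j k i = 0.
  rewrite /nabla_end /dcurv /curv (A2C i k j) (A2C j i k) (A2C k j i).
  mx_ring.
rewrite /nabla_curv (cC i k j) (cC j i k) (cC k j i) => H.
by rewrite -[RHS]H; mx_ring.
Qed.

Variable G : M.
Hypothesis G_sym : G^T = G.
Hypothesis G_unit : G \in unitmx.
Hypothesis curv_skew : forall i j, curv i j *m G + G *m (curv i j)^T = 0.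
Hypothesis dcurv_skew : forall k i j, let D := A k *m G + G *m (A k)^T in
  dcurv k i j *m G + curv i j *m D + (D *m (curv i j)^T + G *m (dcurv k i j)^T)
  = 0.

(** The curvature is skew for the metric; differentiating this relation and
    using that the metric is parallel, so is its covariant derivative. *)
Lemma nabla_curv_skew k i j :
  nabla_curv k i j *m G + G *m (nabla_curv k i j)^T = 0.
Proof.
have H1 := mx_skew_sum (index_enum 'I_n) (A k i) (fun p => curv_skew p j).
have H2 := mx_skew_sum (index_enum 'I_n) (A k j) (fun p => curv_skew p i).
rewrite -/(conn_contract k i j) in H1; rewrite -/(conn_contract k j i) in H2.
have H3 := dcurv_skew k i j; have H4 := curv_skew i j.
have H5 : A k *m (curv i j *m G + G *m (curv i j)^T) = 0 by rewrite H4 mulmx0.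
have H6 : (curv i j *m G + G *m (curv i j)^T) *m (A k)^T = 0 by rewrite H4 mul0mx.
rewrite /nabla_curv /nabla_end.
move: (dcurv k i j) (curv i j) (conn_contract k i j) (conn_contract k j i)
  H1 H2 H3 H5 H6 => dF F P Q H1 H2 H3 H5 H6.
have -> : 0 = (dF *m G + F *m (A k *m G + G *m (A k)^T) +
   ((A k *m G + G *m (A k)^T) *m F^T + G *m dF^T))
   - A k *m (F *m G + G *m F^T) - (F *m G + G *m F^T) *m (A k)^T
   - (P *m G + G *m P^T) + (Q *m G + G *m Q^T).
  by rewrite H1 H2 H3 H5 H6 !subr0 addr0.
mx_ring.
Qed.

Local Notation H := (invmx G).

Lemma invmx_symE i j : H i j = H j i.
Proof. by rewrite -[in LHS]G_sym -trmx_inv mxE. Qed.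

(** Contracts the direction of differentiation of nabla R with an endomorphism
    index: by skewness the inverse metric passes through the curvature matrix,
    and the remaining trace is that of the covariant derivative of Ricci. *)
Lemma contract_nabla_curv k : \sum_j \sum_l H j l * (\sum_i nabla_curv i j k l i)
  = - \sum_i \sum_p H p i * nabla_ric i k p.
Proof.
have E i j : H *m nabla_curv i j k = - (nabla_curv i j k)^T *m H.
  apply: (can_inj (mulKmx G_unit)); apply: (can_inj (mulmxK G_unit)).
  rewrite mulKVmx// mulmxA mulmxKV// mulmxN -sub0r; apply/eqP.
  by rewrite eq_sym subr_eq addrC eq_sym; apply/eqP; rewrite addrC nabla_curv_skew.
transitivity (\sum_i \sum_j (H *m nabla_curv i j k) j i).
  rewrite [RHS]exchange_big/=; apply: eq_bigr => j _.
  under eq_bigr do rewrite mulr_sumr.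
  by rewrite exchange_big/=; apply: eq_bigr => i _; rewrite mxE.
rewrite -sumrN; apply: eq_bigr => i _; under eq_bigr do rewrite E mxE.
rewrite exchange_big/= -sumrN; apply: eq_bigr => p _.
rewrite -trace_nabla_curv mulr_sumr -sumrN; apply: eq_bigr => j _.
by rewrite nabla_curvC !mxE; ring.
Qed.

(** If nabla_k Ric = - rho_k g, the doubly contracted second Bianchi identity,
    d scal = 2 div Ric, reads n rho = 2 rho. *)
Lemma contracted_bianchi (rho : 'I_n -> R) :
  (forall k j l, nabla_ric k j l = - rho k * G j l) ->
  forall k, rho k *+ n = rho k *+ 2.
Proof.
move=> Hric k.
have GH p q : \sum_i G p i * H i q = (p == q)%:R.
  by have := mulmxV G_unit => /matrixP/(_ p q); rewrite !mxE.
have pick : \sum_p rho p * (k == p)%:R = rho k.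
  rewrite (bigD1 k)//= eqxx mulr1 big1 ?addr0// => p pk.
  by rewrite eq_sym (negPf pk) mulr0.
(* the derivative of the scalar curvature *)
have T1 : \sum_j \sum_l H j l * nabla_ric k j l = - (rho k *+ n).
  transitivity (\sum_(j < n) - rho k); last first.
    by rewrite sumr_const card_ord mulNrn.
  apply: eq_bigr => j _; transitivity (- rho k * \sum_l G j l * H l j).
    by rewrite mulr_sumr; apply: eq_bigr => l _; rewrite Hric invmx_symE; ring.
  by rewrite GH eqxx mulr1.
(* the divergence of the Ricci tensor *)
have T2 : \sum_j \sum_l H j l * nabla_ric j k l = - rho k.
  transitivity (- \sum_j rho j * (k == j)%:R); last by rewrite pick.
  rewrite -sumrN; apply: eq_bigr => j _; rewrite -GH mulr_sumr -sumrN.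
  by apply: eq_bigr => l _; rewrite Hric invmx_symE; ring.
have T3 : \sum_i \sum_p H p i * nabla_ric i k p = - rho k.
  by rewrite -[RHS]T2; apply: eq_bigr => i _; apply: eq_bigr => p _; rewrite invmx_symE.
have E j l : \sum_i nabla_curv i j k l i = nabla_ric j k l - nabla_ric k j l.
  rewrite -!trace_nabla_curv -sumrB; apply: eq_bigr => i _.
  have := second_bianchi k i j; rewrite (nabla_curvC j i k).
  move: (nabla_curv k i j) (nabla_curv i j k) (nabla_curv j i k) => X Y Z.
  move=> /matrixP/(_ l i); rewrite !mx_entryE => Hb.
  by rewrite -[LHS]subr0 -Hb; ring.
have := contract_nabla_curv k; rewrite T3 opprK.
under eq_bigr do under eq_bigr do rewrite E mulrBr.
under eq_bigr do rewrite sumrB.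
rewrite sumrB T1 T2 opprK => /eqP; rewrite addrC subr_eq => /eqP ->.
by rewrite mulr2n.
Qed.

End Bianchi.

(** * Algebra of a deformation of the metric at a point *)

Section ConformalDeformation.
Variables (R : comUnitRingType) (n : nat).
Local Notation M := 'M[R]_n.
Variables (A : 'I_n -> M) (A1 : 'I_n -> 'I_n -> M) (G : M).
(** [xi] is the value of the vector field at the point; row a of [B] is d_a xi
    and [dB a] is d_a B.  [D p] and [DD p a] are the first and second partial
    derivatives d_p G and d_p d_a G of the Gram matrix, rewritten by means of
    nabla g = 0. *)
Variables (xi : 'I_n -> R) (B : M) (dB : 'I_n -> M).

Local Notation D p := (A p *m G + G *m (A p)^T).
Local Notation DD p a :=
  (A1 p a *m G + A a *m D p + (D p *m (A a)^T + G *m (A1 p a)^T)).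

(** Coordinate expressions, in the frame of coordinate fields, of L_xi g, of its
    partial derivative d_a, and of the endomorphism Y |-> (L_xi nabla)(e_a, Y). *)
Definition lie_gram : M := \sum_p xi p *: D p + B *m G + G *m B^T.
Definition dlie_gram a : M := \sum_p (B a p *: D p + xi p *: DD p a)
  + (dB a *m G + B *m D a) + (D a *m B^T + G *m (dB a)^T).
Definition lie_conn a : M := \sum_p xi p *: A1 p a - A a *m B
  + \sum_p B a p *: A p + dB a + B *m A a.

(** Commuting L_xi with nabla g = 0: the covariant derivative of L_xi g is the
    symmetrization of L_xi nabla. *)
Lemma nabla_lie_gram a :
  dlie_gram a - A a *m lie_gram - lie_gram *m (A a)^T =
  lie_conn a *m G + G *m (lie_conn a)^T.
Proof.
have E1 (f : 'I_n -> R) (X : 'I_n -> M) :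
    \sum_p f p *: (X p *m G + G *m (X p)^T) =
    (\sum_p f p *: X p) *m G + G *m (\sum_p f p *: X p)^T.
  rewrite mulmx_suml linear_sum mulmx_sumr -big_split/=; apply: eq_bigr => p _.
  by rewrite linearZ/= -scalemxAl -scalemxAr scalerDr.
have E2 : \sum_p xi p *: DD p a =
    \sum_p xi p *: (A1 p a *m G + G *m (A1 p a)^T)
    + A a *m (\sum_p xi p *: D p) + (\sum_p xi p *: D p) *m (A a)^T.
  rewrite mulmx_suml mulmx_sumr -!big_split/=; apply: eq_bigr => p _.
  by rewrite -scalemxAl -scalemxAr -!scalerDr; congr (_ *: _); mx_ring.
rewrite /dlie_gram big_split/= E2 !E1 /lie_gram E1 /lie_conn.
move: (\sum_p xi p *: A p) (\sum_p B a p *: A p) (\sum_p xi p *: A1 p a).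
move=> X Y Z.
mx_ring.
Qed.

(** In the affine conformal expression of L_xi nabla, the two terms that are not
    multiples of the metric are together skew, so symmetrization removes them. *)
Lemma nabla_lie_gram_conformal (rho : 'I_n -> R) a : G^T = G -> G \in unitmx ->
  (forall b m, lie_conn a b m = rho a * (b == m)%:R + rho b * (a == m)%:R
     - G a b * \sum_p rho p * invmx G p m) ->
  dlie_gram a - A a *m lie_gram - lie_gram *m (A a)^T = (rho a *+ 2) *: G.
Proof.
move=> Gs Gu HC; rewrite nabla_lie_gram.
have Gsym i j : G i j = G j i by rewrite -[in LHS]Gs mxE.
have E b c : (lie_conn a *m G) b c =
    rho a * G b c + rho b * G a c - G a b * rho c.
  pose r : 'rV[R]_n := \row_p rho p.
  have rE m : \sum_p rho p * invmx G p m = (r *m invmx G) 0 m.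
    by rewrite mxE; apply: eq_bigr => p _; rewrite mxE.
  have rc : rho c = \sum_m (r *m invmx G) 0 m * G m c.
    by have := mulmxKV Gu r => /matrixP/(_ 0 c); rewrite !mxE.
  have pick x (f : 'I_n -> R) : \sum_m (x == m)%:R * f m = f x.
    rewrite (bigD1 x)//= eqxx mul1r big1 ?addr0// => p px.
    by rewrite eq_sym (negPf px) mul0r.
  rewrite mxE rc -(pick b (G^~ c)) -(pick a (G^~ c)) !mulr_sumr.
  rewrite -big_split -sumrB/=; apply: eq_bigr => m _.
  by rewrite HC rE; ring.
apply/matrixP => b c.
rewrite [LHS]mxE E (_ : (G *m (lie_conn a)^T) b c = (lie_conn a *m G) c b).
  by rewrite E mxE (Gsym c b); ring.
by rewrite -[G in LHS]Gs -trmx_mul mxE.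
Qed.

Lemma nabla_soliton_ric (rho : 'I_n -> R) a (lambda c : R) : c *+ 2 = 1 ->
  G^T = G -> G \in unitmx ->
  (forall b m, lie_conn a b m = rho a * (b == m)%:R + rho b * (a == m)%:R
     - G a b * \sum_p rho p * invmx G p m) ->
  (lambda *: D a - c *: dlie_gram a)
  - A a *m (lambda *: G - c *: lie_gram)
  - (lambda *: G - c *: lie_gram) *m (A a)^T = - rho a *: G.
Proof.
move=> c2 Gs Gu /(nabla_lie_gram_conformal Gs Gu) H.
have -> : - rho a *: G = - c *: ((rho a *+ 2) *: G).
  by rewrite scalerA mulNr mulrnAr -mulrnAl c2 mul1r.
rewrite -H mulmxBl mulmxBr -!scalemxAl -!scalemxAr.
by mx_ring.
Qed.

End ConformalDeformation.

(** * Locality of the geometric operators *)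

Section GermInvariance.

(** Lets each of the three terms of a Lie derivative or curvature be handled by
    its own locality lemma. *)
Lemma eq_sub3 (W : zmodType) (a b c a' b' c' : W) :
  a = a' -> b = b' -> c = c' -> a - b - c = a' - b' - c'.
Proof. by move=> -> -> ->. Qed.

Variables (R : realType) (n : nat).
Local Notation V := 'rV[R]_n.
Variable G : V -> 'M[R]_n.
Implicit Types (X Y Z xi : V -> V) (x : V).

(** The equations are known for global vector fields, which can be prescribed
    only near a point; this is the relation that every local operator
    respects. *)
Definition same_germ (W : Type) (f g : V -> W) x := \forall y \near x, f y = g y.

(** Equality of germs spreads to nearby points, so it survives the nesting of
    differential operators. *)
Lemma same_germ_near W (f g : V -> W) x :
  same_germ f g x -> \forall y \near x, same_germ f g y.
Proof. exact: (@nbhs_interior V x [set y | f y = g y]). Qed.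

Lemma same_germ_at W (f g : V -> W) x : same_germ f g x -> f x = g x.
Proof. exact: nbhs_singleton. Qed.

Lemma same_germ_refl W (f : V -> W) x : same_germ f f x.
Proof. by rewrite /same_germ; near=> y. Unshelve. all: by end_near. Qed.

Lemma levi_civita_germ X X' Y Y' x : same_germ X X' x -> same_germ Y Y' x ->
  same_germ (levi_civita G X Y) (levi_civita G X' Y') x.
Proof.
move=> hX hY.
apply: filterS2 hX (same_germ_near hY) => y {}hX {}hY.
by rewrite /levi_civita hX (near_eq_derive _ hY) (same_germ_at hY).
Qed.

Lemma bracket_germ X X' Y Y' x : same_germ X X' x -> same_germ Y Y' x ->
  same_germ (bracket X Y) (bracket X' Y') x.
Proof.
move=> /same_germ_near hX /same_germ_near hY.
apply: filterS2 hX hY => y {}hX {}hY.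
by rewrite /bracket (same_germ_at hX) (same_germ_at hY)
   (near_eq_derive _ hY) (near_eq_derive _ hX).
Qed.

Lemma inner_germ X X' Y Y' x : same_germ X X' x -> same_germ Y Y' x ->
  same_germ (inner G X Y) (inner G X' Y') x.
Proof. by move=> hX hY; apply: filterS2 hX hY => y {}hX {}hY; rewrite /inner hX hY. Qed.

Lemma lie_metric_germ xi X X' Y Y' x : same_germ X X' x -> same_germ Y Y' x ->
  lie_metric G xi X Y x = lie_metric G xi X' Y' x.
Proof.
move=> hX hY; have hxi := same_germ_refl xi x.
rewrite /lie_metric; apply: eq_sub3.
- exact: near_eq_derive (inner_germ hX hY).
- exact: same_germ_at (inner_germ (bracket_germ hxi hX) hY).
- exact: same_germ_at (inner_germ hX (bracket_germ hxi hY)).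
Qed.

Lemma lie_connection_germ xi X X' Y Y' x : same_germ X X' x ->
  same_germ Y Y' x -> lie_connection G xi X Y x = lie_connection G xi X' Y' x.
Proof.
move=> hX hY; have hxi := same_germ_refl xi x.
rewrite /lie_connection; apply: eq_sub3.
- exact: same_germ_at (bracket_germ hxi (levi_civita_germ hX hY)).
- exact: same_germ_at (levi_civita_germ (bracket_germ hxi hX) hY).
- exact: same_germ_at (levi_civita_germ hX (bracket_germ hxi hY)).
Qed.

Lemma riemann_germ X X' Y Y' Z Z' x : same_germ X X' x -> same_germ Y Y' x ->
  same_germ Z Z' x -> riemann G X Y Z x = riemann G X' Y' Z' x.
Proof.
move=> hX hY hZ; rewrite /riemann; apply: eq_sub3.
- exact: same_germ_at (levi_civita_germ hX (levi_civita_germ hY hZ)).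
- exact: same_germ_at (levi_civita_germ hY (levi_civita_germ hX hZ)).
- exact: same_germ_at (levi_civita_germ (bracket_germ hX hY) hZ).
Qed.

Lemma ricci_germ Y Y' Z Z' x : same_germ Y Y' x -> same_germ Z Z' x ->
  ricci G Y Z x = ricci G Y' Z' x.
Proof.
move=> hY hZ; rewrite /ricci /mxtrace; apply: eq_bigr => i _; rewrite [LHS]mxE [RHS]mxE.
have := riemann_germ (same_germ_refl (fun=> delta_mx 0 i) x) hY hZ.
by move=> /rowP; apply.
Qed.

End GermInvariance.

(** * Partial derivatives of matrix-valued functions *)

Section MatrixPartial.
Variables (R : realType) (n : nat).
Local Notation V := 'rV[R]_n.
Implicit Types (x : V) (k : 'I_n).

Lemma differentiable_entry p q (X : V -> 'M[R]_(p, q)) x i j :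
  differentiable X x -> differentiable (fun y => X y i j) x.
Proof. by move/differentiable_mxP. Qed.

Lemma fun_sumE (I : Type) (W : zmodType) (r : seq I) (f : I -> V -> W) :
  (fun y => \sum_(i <- r) f i y) = \sum_(i <- r) f i.
Proof. by apply/funext => y; rewrite fct_sumE. Qed.

Lemma differentiable_sum_fun (W : normedModType R) m (f : 'I_m -> V -> W) x :
  (forall i, differentiable (f i) x) ->
  differentiable (fun y => \sum_i f i y) x.
Proof. by move=> df; rewrite fun_sumE; exact: differentiable_sum. Qed.

Lemma partial_sum (W : normedModType R) m (f : 'I_m -> V -> W) k x :
  (forall i, differentiable (f i) x) ->
  partial k (fun y => \sum_i f i y) x = \sum_i partial k (f i) x.
Proof.
move=> df; rewrite /partial fun_sumE derive_sum// => i.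
exact: diff_derivable.
Qed.

Lemma partial_opp (W : normedModType R) (f : V -> W) k x :
  differentiable f x -> partial k (fun y => - f y) x = - partial k f x.
Proof. by move=> df; rewrite /partial deriveN//; exact: diff_derivable. Qed.

Lemma partial_sub (W : normedModType R) (f g : V -> W) k x :
  differentiable f x -> differentiable g x ->
  partial k (fun y => f y - g y) x = partial k f x - partial k g x.
Proof. by move=> df dg; rewrite /partial deriveB//; exact: diff_derivable. Qed.

Lemma partial_cscale (W : normedModType R) c (f : V -> W) k x :
  differentiable f x -> partial k (fun y => c *: f y) x = c *: partial k f x.
Proof. by move=> df; rewrite /partial deriveZ//; exact: diff_derivable. Qed.

Lemma differentiable_mulmx p q r (X : V -> 'M[R]_(p, q)) (Y : V -> 'M[R]_(q, r)) x :
  differentiable X x -> differentiable Y x ->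
  differentiable (fun y => X y *m Y y) x.
Proof.
move=> dX dY; apply/differentiable_mxP => i j.
rewrite (_ : (fun y => _) = fun y => \sum_k X y i k * Y y k j); last first.
  by apply/funext => y; rewrite mxE.
apply: differentiable_sum_fun => k.
by apply: differentiableM; apply: differentiable_entry.
Qed.

Lemma partial_mulmx p q r (X : V -> 'M[R]_(p, q)) (Y : V -> 'M[R]_(q, r)) k x :
  differentiable X x -> differentiable Y x ->
  partial k (fun y => X y *m Y y) x =
  partial k X x *m Y x + X x *m partial k Y x.
Proof.
move=> dX dY; apply/matrixP => i j.
rewrite partial_mx; last exact: differentiable_mulmx.
rewrite (_ : (fun y => _) = fun y => \sum_m X y i m * Y y m j); last first.
  by apply/funext => y; rewrite mxE.
rewrite partial_sum => [|m]; last first.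
  by apply: differentiableM; apply: differentiable_entry.
rewrite !mxE -big_split/=; apply: eq_bigr => m _.
by rewrite partialM ?partial_mx//; apply: differentiable_entry.
Qed.

Lemma differentiable_trmx p q (X : V -> 'M[R]_(p, q)) x :
  differentiable X x -> differentiable (fun y => (X y)^T) x.
Proof.
move=> dX; apply/differentiable_mxP => i j.
rewrite (_ : (fun y => _) = fun y => X y j i); first exact: differentiable_entry.
by apply/funext => y; rewrite mxE.
Qed.

Lemma partial_trmx p q (X : V -> 'M[R]_(p, q)) k x :
  differentiable X x -> partial k (fun y => (X y)^T) x = (partial k X x)^T.
Proof.
move=> dX; apply/matrixP => i j; rewrite mxE !partial_mx//; last first.
  exact: differentiable_trmx.
rewrite (_ : (fun y => (X y)^T i j) = fun y => X y j i)//.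
by apply/funext => y; rewrite mxE.
Qed.

Lemma differentiable_scalemx p q (f : V -> R) (X : V -> 'M[R]_(p, q)) x :
  differentiable f x -> differentiable X x ->
  differentiable (fun y => f y *: X y) x.
Proof.
move=> df dX; apply/differentiable_mxP => i j.
rewrite (_ : (fun y => _) = fun y => f y * X y i j); last first.
  by apply/funext => y; rewrite mxE.
by apply: differentiableM => //; exact: differentiable_entry.
Qed.

Lemma partial_scalemx p q (f : V -> R) (X : V -> 'M[R]_(p, q)) k x :
  differentiable f x -> differentiable X x ->
  partial k (fun y => f y *: X y) x = partial k f x *: X x + f x *: partial k X x.
Proof.
move=> df dX; apply/matrixP => i j.
rewrite partial_mx; last exact: differentiable_scalemx.
rewrite (_ : (fun y => _) = fun y => f y * X y i j); last first.
  by apply/funext => y; rewrite mxE.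
by rewrite partialM ?mxE ?partial_mx//; exact: differentiable_entry.
Qed.

Lemma differentiable_add (W : normedModType R) (f g : V -> W) x :
  differentiable f x -> differentiable g x ->
  differentiable (fun y => f y + g y) x.
Proof. exact: differentiableD. Qed.

Lemma differentiable_sub (W : normedModType R) (f g : V -> W) x :
  differentiable f x -> differentiable g x ->
  differentiable (fun y => f y - g y) x.
Proof. exact: differentiableB. Qed.

Lemma partial_swap_mx p q (U : set V) (X : V -> 'M[R]_(p, q)) i j x :
  open U -> Ck 2 U X -> U x ->
  partial i (partial j X) x = partial j (partial i X) x.
Proof.
move=> oU CX Ux; apply/matrixP => a b.
have dX y : U y -> differentiable X y by move=> /(Ck_differentiable CX).
have E k l : partial k (partial l X) x a b = partial k (partial l (fun y => X y a b)) x.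
  rewrite partial_mx; last exact: (Ck_differentiable (Ck_partial l CX) Ux).
  by apply: (open_eq_partial _ oU) Ux => y Uy; rewrite partial_mx//; exact: dX.
have Cab : Ck 2 U (fun y => X y a b) by exact: ((Ck_mxP _ _ oU).1 CX).
exact: etrans (E i j) (etrans (partial_swap i j oU Cab Ux) (esym (E j i))).
Qed.

End MatrixPartial.

(** * The soliton equations in a coordinate frame *)

Section PosDef.
Variables (R : realType) (n : nat).

(** A vector in the kernel of G would have zero length. *)
Lemma posdef_unitmx (G : 'M[R]_n) :
  (forall u, u != 0 -> 0 < bilin G u u) -> G \in unitmx.
Proof.
move=> pos; rewrite -row_free_unit -kermx_eq0; apply/negPn/negP.
case/rowV0Pn => u /sub_kermxP uG u0.
by have := pos u u0; rewrite /bilin uG mul0mx mxE ltxx.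
Qed.

End PosDef.

Section LocalComputation.
Variables (R : realType) (n : nat).
Local Notation V := 'rV[R]_n.
Local Notation e_ a := (delta_mx 0 a : V).
Variables (U : set V) (oU : open U) (G : V -> 'M[R]_n).
Hypothesis G_smooth : forall k, Ck k U G.
Hypothesis G_sym : forall x, U x -> (G x)^T = G x.
Hypothesis G_pos : forall x, U x -> forall u, u != 0 -> 0 < bilin (G x) u u.

Lemma G_unit x : U x -> G x \in unitmx.
Proof. by move=> /G_pos; exact: posdef_unitmx. Qed.

Lemma G_symE x i j : U x -> G x i j = G x j i.
Proof. by move=> Ux; rewrite -[in LHS]G_sym// mxE. Qed.

Lemma metric_entry_Ck k i j : Ck k U (fun x => G x i j).
Proof. exact: ((Ck_mxP _ _ oU).1 (G_smooth k)). Qed.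

(** Entry (j, k) is Gamma^k_ij: the connection matrix in the direction e_i, acting
    on row vectors. *)
Definition conn (i : 'I_n) (x : V) : 'M[R]_n :=
  \matrix_(j, k) christoffel G k i j x.

Lemma conn_Ck k i : Ck k U (conn i).
Proof.
apply/Ck_mxP => // j l.
have Cd a b c : Ck k U (dgram G a b c) by exact: Ck_partial (metric_entry_Ck k.+1 b c).
have Cs := Ck_sum oU (index_enum 'I_n) xpredT (fun m =>
  CkM oU (Ck_invmx oU G_unit (fun a b => metric_entry_Ck k a b) l m)
         (CkB oU (CkD oU (Cd i j m) (Cd j i m)) (Cd m i j))).
apply: eq_Ck (CkM oU (Ck_cst k U (2^-1 : R)) Cs) => // x _.
by rewrite mxE.
Qed.

Lemma conn_torsion_free x i j k : U x -> conn i x j k = conn j x i k.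
Proof.
move=> Ux; rewrite !mxE /christoffel; congr (_ * _); apply: eq_bigr => l _.
congr (_ * _); rewrite [dgram G i j l x + _]addrC; congr (_ - _).
by apply: (open_eq_partial _ oU _ Ux) => y Uy; exact: G_symE.
Qed.

Lemma dgramC k i j x : U x -> dgram G k i j x = dgram G k j i x.
Proof. by move=> Ux; apply: (open_eq_partial _ oU _ Ux) => y; exact: G_symE. Qed.

(** Lowering the index removes the inverse matrix from the Koszul formula. *)
Lemma conn_mulG x i j k : U x -> (conn i x *m G x) j k =
  2^-1 * (dgram G i j k x + dgram G j i k x - dgram G k i j x).
Proof.
move=> Ux.
pose w : V :=
  \row_l (dgram G i j l x + dgram G j i l x - dgram G l i j x).
have -> : (conn i x *m G x) j k = 2^-1 * (w *m invmx (G x) *m G x) 0 k.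
  rewrite !mxE mulr_sumr; apply: eq_bigr => m _; rewrite !mxE mulrA.
  congr (_ * _ * _); apply: eq_bigr => l _; rewrite !mxE mulrC.
  congr (_ * _); rewrite -[in RHS](G_sym Ux) -trmx_inv mxE //.
by rewrite mulmxKV ?G_unit// mxE.
Qed.

(** The connection is metric: nabla g = 0. *)
Lemma partial_metric k x : U x ->
  partial k G x = conn k x *m G x + G x *m (conn k x)^T.
Proof.
move=> Ux; apply/matrixP => i j.
rewrite partial_mx; last exact: Ck_differentiable (G_smooth 0) Ux.
have E : (G x *m (conn k x)^T) i j = (conn k x *m G x) j i.
  by rewrite -[in LHS](G_sym Ux) -trmx_mul [LHS]mxE.
rewrite mx_entryD E !conn_mulG//.
transitivity (dgram G k i j x) => //; rewrite (dgramC k j i Ux).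
by move: (dgram _ k i j x) (dgram _ i k j x) (dgram _ j k i x) => a b c; field.
Qed.

Lemma differentiable_conn i x : U x -> differentiable (conn i) x.
Proof. exact: Ck_differentiable (conn_Ck 0 i). Qed.

Lemma differentiable_metric x : U x -> differentiable G x.
Proof. exact: Ck_differentiable (G_smooth 0). Qed.

Lemma differentiable_dconn k i x : U x -> differentiable (partial k (conn i)) x.
Proof. exact: (Ck_differentiable (Ck_partial k (conn_Ck 1 i))). Qed.

Definition dconn x k i := partial k (conn i) x.
Definition ddconn x l k i := partial l (partial k (conn i)) x.
Local Notation A x := (conn^~ x).
Definition curvature i j x : 'M[R]_n := curv (A x) (dconn x) i j.

Lemma ddconnC x l k i : U x -> ddconn x l k i = ddconn x k l i.
Proof. by move=> Ux; exact: partial_swap_mx oU (conn_Ck 2 i) Ux. Qed.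

Local Ltac diff_auto :=
  lazymatch goal with |- @differentiable_def _ _ _ ?f _ _ =>
    lazymatch f with
    | G => by exact: differentiable_metric
    | conn _ => by exact: differentiable_conn
    | curvature _ _ => done
    | partial _ (conn _) => by exact: differentiable_dconn
    | fun y => (@?a y)^T => apply: differentiable_trmx; diff_auto
    | fun y => @?a y *m @?b y => apply: differentiable_mulmx; diff_auto
    | fun y => @?a y + - @?b y => apply: differentiable_sub; diff_auto
    | fun y => @?a y + @?b y => apply: differentiable_add; diff_auto
    end
  end.

Lemma partial_curvature k i j x : U x ->
  partial k (curvature i j) x = dcurv (A x) (dconn x) (ddconn x) k i j.
Proof.
move=> Ux; rewrite /curvature /curv /dcurv /dconn.
rewrite partial_sub; [|by diff_auto..].
rewrite partialD; [|by diff_auto..].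
rewrite partial_sub; [|by diff_auto..].
by rewrite !partial_mulmx; [|by diff_auto..].
Qed.

Lemma differentiable_curvature i j x : U x -> differentiable (curvature i j) x.
Proof. by move=> Ux; rewrite /curvature /curv /dconn; diff_auto. Qed.

Local Notation DG k x := (conn k x *m G x + G x *m (conn k x)^T).

Lemma partial2_metric i j x : U x -> partial i (partial j G) x =
  dconn x i j *m G x + conn j x *m DG i x
  + (DG i x *m (conn j x)^T + G x *m (dconn x i j)^T).
Proof.
move=> Ux; rewrite (open_eq_partial _ oU (fun y => @partial_metric j y) Ux).
rewrite partialD; [|by diff_auto..].
by rewrite !partial_mulmx ?partial_trmx ?partial_metric//; diff_auto.
Qed.

(** Expresses that the second partial derivatives of the Gram matrix are
    symmetric. *)
Lemma curvature_skew i j x : U x ->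
  curvature i j x *m G x + G x *m (curvature i j x)^T = 0.
Proof.
move=> Ux; have := etrans (esym (partial2_metric i j Ux))
  (etrans (partial_swap_mx i j oU (G_smooth 2) Ux) (partial2_metric j i Ux)).
rewrite /curvature /curv.
move: (G x) (conn i x) (conn j x) (dconn x i j) (dconn x j i) => g a b c d.
by move=> /eqP; rewrite -subr_eq0 => /eqP <-; mx_ring.
Qed.

(** The partial derivative of the relation [curvature_skew]. *)
Lemma dcurvature_skew k i j x : U x ->
  let D := conn k x *m G x + G x *m (conn k x)^T in
  let dF := dcurv (A x) (dconn x) (ddconn x) k i j in
  dF *m G x + curvature i j x *m D + (D *m (curvature i j x)^T + G x *m dF^T)
  = 0.
Proof.
move=> Ux D dF.
have dc := differentiable_curvature i j Ux.
have := @open_eq_partial _ _ _ U (fun y => curvature i j y *m G y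
  + G y *m (curvature i j y)^T) (fun=> 0) k x oU
  (fun y => @curvature_skew i j y) Ux.
rewrite [RHS]partial_cst partialD; [|by diff_auto..].
rewrite !partial_mulmx; [|by diff_auto..].
by rewrite partial_trmx ?partial_metric ?partial_curvature.
Qed.

Local Notation cst_ a := (fun _ : V => e_ a).

Lemma levi_civitaE (X Y : V -> V) x : levi_civita G X Y x =
  'D_(X x) Y x + Y x *m (\sum_i X x 0 i *: conn i x).
Proof.
congr (_ + _); apply/rowP => k; rewrite !mxE.
under [RHS]eq_bigr do rewrite summxE mulr_sumr.
rewrite exchange_big/=; apply: eq_bigr => i _; apply: eq_bigr => j _.
by rewrite !mxE; ring.
Qed.

Lemma sum_delta (W : lmodType R) a (f : 'I_n -> W) :
  \sum_i (e_ a) 0 i *: f i = f a.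
Proof.
rewrite (bigD1 a)//= mxE !eqxx scale1r big1 ?addr0// => i ia.
by rewrite mxE (negPf ia) andbF scale0r.
Qed.

Lemma levi_civita_frame a (Y : V -> V) x :
  levi_civita G (cst_ a) Y x = partial a Y x + Y x *m conn a x.
Proof. by rewrite levi_civitaE sum_delta. Qed.

(** The value of nabla_(e_a) e_b is a row of the connection matrix; all
    computations below use constant fields, whose derivatives vanish. *)
Lemma levi_civita_frame2 a b :
  levi_civita G (cst_ a) (cst_ b) = fun x => row b (conn a x).
Proof.
by apply/funext => x; rewrite levi_civita_frame partial_cst add0r rowE.
Qed.

Lemma bracket_frame a b : bracket (cst_ a) (cst_ b) = fun=> 0.
Proof. by apply/funext => x; rewrite /bracket !derive_cst subr0. Qed.

Lemma partial_row a b i x : U x ->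
  partial a (fun y => row b (conn i y)) x = row b (dconn x a i).
Proof.
move=> Ux; have dc := differentiable_conn i Ux.
apply/rowP => j; rewrite partial_mx; last first.
  apply/differentiable_mxP => i' j'.
  rewrite (_ : (fun y => _) = fun y => conn i y b j'); last first.
    by apply/funext => y; rewrite [LHS]mxE.
  exact: differentiable_entry.
rewrite mxE /dconn partial_mx//.
rewrite (_ : (fun y => _) = fun y => conn i y b j)//.
by apply/funext => y; rewrite [LHS]mxE.
Qed.

Lemma riemann_frame i j l x : U x ->
  riemann G (cst_ i) (cst_ j) (cst_ l) x = row l (curvature i j x).
Proof.
move=> Ux; rewrite /riemann bracket_frame !levi_civita_frame2.
rewrite !levi_civita_frame !partial_row// levi_civitaE derive0.
rewrite [\sum_i _]big1 ?mulmx0; last by move=> p _; rewrite mxE scale0r.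
rewrite addr0 subr0 /curvature /curv.
move: (conn i x) (conn j x) (dconn x i j) (dconn x j i) => a b d d'.
rewrite -!row_mul.
apply/rowP => c; rewrite row_entry !mx_entryE !row_entry; ring.
Qed.

Lemma ricci_frame j l x : U x ->
  ricci G (cst_ j) (cst_ l) x = ric (A x) (dconn x) j l.
Proof.
move=> Ux; rewrite /ricci /mxtrace; apply: eq_bigr => i _; rewrite [LHS]mxE.
by rewrite riemann_frame// [LHS]mxE.
Qed.

Lemma inner_frame a b : inner G (cst_ a) (cst_ b) = fun x => G x a b.
Proof.
by apply/funext => x; rewrite /inner /bilin -rowE trmx_delta -colE !mxE.
Qed.

Variable xi : V -> V.
Hypothesis xi_smooth : forall k, Ck k U xi.

Definition dxi x : 'M[R]_n := \matrix_(a, p) partial a xi x 0 p.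
Definition xi_coord x p : R := xi x 0 p.

Lemma differentiable_xi x : U x -> differentiable xi x.
Proof. exact: Ck_differentiable (xi_smooth 0). Qed.

Lemma row_dxi a x : row a (dxi x) = partial a xi x.
Proof. by apply/rowP => p; rewrite !mxE. Qed.

Lemma derive_xi v x : U x -> 'D_v xi x = v *m dxi x.
Proof.
move=> Ux; rewrite derive_partial; last exact: differentiable_xi.
rewrite mulmx_sum_row; by apply: eq_bigr => a _; rewrite row_dxi.
Qed.

Lemma bracket_xi_frame a : bracket xi (cst_ a) = fun x => - partial a xi x.
Proof. by apply/funext => x; rewrite /bracket derive_cst sub0r. Qed.

Lemma differentiable_dxi x : U x -> differentiable dxi x.
Proof.
move=> Ux; apply/differentiable_mxP => a p.
rewrite (_ : (fun y => _) = fun y => partial a xi y 0 p); last first.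
  by apply/funext => y; rewrite mxE.
apply: differentiable_entry.
exact: (Ck_differentiable (Ck_partial a (xi_smooth 1)) Ux).
Qed.

Lemma row_ddxi a b x : U x ->
  row b (partial a dxi x) = partial a (partial b xi) x.
Proof.
move=> Ux; apply/rowP => p; rewrite mxE partial_mx; last exact: differentiable_dxi.
rewrite [RHS]partial_mx; last first.
  exact: (Ck_differentiable (Ck_partial b (xi_smooth 1)) Ux).
rewrite (_ : (fun y => dxi y b p) = fun y => partial b xi y 0 p)//.
by apply/funext => y; rewrite mxE.
Qed.

Definition lieG x := lie_gram (A x) (G x) (xi_coord x) (dxi x).

Lemma lie_metric_frame a b x : U x ->
  lie_metric G xi (cst_ a) (cst_ b) x = lieG x a b.
Proof.
move=> Ux; rewrite /lie_metric inner_frame !bracket_xi_frame.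
rewrite derive_partial; last by apply: differentiable_entry; exact: differentiable_metric.
have -> : inner G (fun y => - partial a xi y) (cst_ b) x = - (dxi x *m G x) a b.
  rewrite /inner /bilin trmx_delta -row_dxi rowE !mulNmx -!mulmxA -rowE -colE.
  by rewrite !mxE; congr (- _); apply: eq_bigr => p _; rewrite !mxE.
have -> : inner G (cst_ a) (fun y => - partial b xi y) x = - (G x *m (dxi x)^T) a b.
  rewrite /inner /bilin -row_dxi linearN/= mulmxN tr_row -rowE !mxE.
  by congr (- _); apply: eq_bigr => p _; rewrite !mxE.
rewrite !opprK /lieG /lie_gram !mx_entryD; congr (_ + _ + _).
rewrite summxE; apply: eq_bigr => p _; rewrite mx_entryZ -partial_metric//.
by rewrite partial_mx//; exact: differentiable_metric.
Qed.

Lemma lie_connection_frame a b x : U x ->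
  lie_connection G xi (cst_ a) (cst_ b) x =
  row b (lie_conn (A x) (dconn x) (xi_coord x) (dxi x) (fun a => partial a dxi x) a).
Proof.
move=> Ux; rewrite /lie_connection levi_civita_frame2 !bracket_xi_frame.
have T1 : bracket xi (fun x => row b (conn a x)) x =
    row b (\sum_p xi_coord x p *: dconn x p a) - row b (conn a x *m dxi x).
  rewrite /bracket derive_xi// row_mul; congr (_ - _).
  rewrite derive_partial; last first.
    apply/differentiable_mxP => i' j'.
    rewrite (_ : (fun y => _) = fun y => conn a y b j'); last first.
      by apply/funext => y; rewrite [LHS]mxE.
    by apply: differentiable_entry; exact: differentiable_conn.
  rewrite linear_sum; apply: eq_bigr => p _.
  by rewrite linearZ/= partial_row.
have T2 : levi_civita G (fun y => - partial a xi y) (cst_ b) x =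
    - row b (\sum_p dxi x a p *: conn p x).
  rewrite levi_civitaE derive_cst add0r -rowE -linearN/= -sumrN.
  congr (row b _); apply: eq_bigr => p _.
  by rewrite -row_dxi mx_entryN row_entry scaleNr.
have T3 : levi_civita G (cst_ a) (fun y => - partial b xi y) x =
    - row b (partial a dxi x) - row b (dxi x *m conn a x).
  rewrite levi_civita_frame partial_opp; last first.
    exact: (Ck_differentiable (Ck_partial b (xi_smooth 1)) Ux).
  by rewrite -row_ddxi// -row_dxi row_mul mulNmx.
rewrite T1 T2 T3 /lie_conn.
move: (\sum_p xi_coord x p *: dconn x p a) (\sum_p dxi x a p *: conn p x) => X Y.
move: (conn a x *m dxi x) (dxi x *m conn a x) (partial a dxi x) => P Q S.
by apply/rowP => c; rewrite row_entry !mx_entryE !row_entry; ring.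
Qed.

Lemma differentiable_xi_coord p x : U x -> differentiable (xi_coord^~ p) x.
Proof. by move=> Ux; apply: differentiable_entry; exact: differentiable_xi. Qed.

Lemma partial_lieG a x : U x -> partial a lieG x =
  dlie_gram (A x) (dconn x) (G x) (xi_coord x) (dxi x) (fun a => partial a dxi x) a.
Proof.
move=> Ux; pose L y := \sum_p xi_coord y p *: partial p G y
  + dxi y *m G y + G y *m (dxi y)^T.
have ddG p : differentiable (partial p G) x.
  exact: (Ck_differentiable (Ck_partial p (G_smooth 1)) Ux).
have dB := differentiable_dxi Ux; have dG := differentiable_metric Ux.
rewrite (@open_eq_partial _ _ _ U lieG L)//; last first.
  move=> y Uy; rewrite /lieG /lie_gram /L; congr (_ + _ + _).
  by apply: eq_bigr => p _; rewrite partial_metric.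
have d1 : differentiable (fun y => \sum_p xi_coord y p *: partial p G y) x.
  apply: differentiable_sum_fun => p; apply: differentiable_scalemx => //.
  exact: differentiable_xi_coord.
have d2 : differentiable (fun y => dxi y *m G y) x.
  exact: differentiable_mulmx.
have d3 : differentiable (fun y => (dxi y)^T) x by exact: differentiable_trmx.
rewrite partialD; [|exact: differentiable_add|exact: differentiable_mulmx].
rewrite partialD// partial_sum => [|p]; last first.
  by apply: differentiable_scalemx => //; exact: differentiable_xi_coord.
rewrite !partial_mulmx// partial_trmx// partial_metric// /dlie_gram.
congr (_ + _ + _); apply: eq_bigr => p _.
rewrite partial_scalemx//; last exact: differentiable_xi_coord.
rewrite partial_metric// (partial_swap_mx a p oU (G_smooth 2) Ux) partial2_metric//.
by rewrite mxE partial_mx//; exact: differentiable_xi.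
Qed.

Lemma partial_ric k j l x : U x ->
  partial k (fun y => ric (A y) (dconn y) j l) x =
  dric (A x) (dconn x) (ddconn x) k j l.
Proof.
move=> Ux; rewrite partial_sum => [|i]; last first.
  by apply: differentiable_entry; exact: differentiable_curvature.
apply: eq_bigr => i _; rewrite -partial_curvature//.
apply/esym; apply: (@partial_mx _ _ _ _ (curvature i j)).
exact: differentiable_curvature.
Qed.

Variables (lambda : R) (r : V -> R).
Hypothesis soliton : forall a b x, U x ->
  2^-1 * lie_metric G xi (cst_ a) (cst_ b) x + ricci G (cst_ a) (cst_ b) x
  = lambda * inner G (cst_ a) (cst_ b) x.
Hypothesis conformal : forall a b x, U x ->
  lie_connection G xi (cst_ a) (cst_ b) x =
    'D_(e_ a) r x *: e_ b + 'D_(e_ b) r x *: e_ a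
    - inner G (cst_ a) (cst_ b) x *: gradient G r x.

Lemma ric_soliton x a b : U x -> ric (A x) (dconn x) a b =
  (lambda *: G x - 2^-1 *: lieG x) a b.
Proof.
move=> Ux; have := soliton a b Ux.
rewrite lie_metric_frame// ricci_frame// inner_frame.
move: (lieG x) (G x) => L g Hs.
by rewrite !mx_entryE -Hs addrAC subrr add0r.
Qed.

Definition ricM x : 'M[R]_n := \matrix_(j, l) ric (A x) (dconn x) j l.

Lemma ricM_soliton x : U x -> ricM x = lambda *: G x - 2^-1 *: lieG x.
Proof. by move=> Ux; apply/matrixP => a b; rewrite mxE ric_soliton. Qed.

Lemma lie_conn_conformal x a b m : U x ->
  lie_conn (A x) (dconn x) (xi_coord x) (dxi x) (fun a => partial a dxi x) a b m =
  partial a r x * (b == m)%:R + partial b r x * (a == m)%:R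
  - G x a b * \sum_p partial p r x * invmx (G x) p m.
Proof.
move=> Ux; have := conformal a b Ux.
rewrite lie_connection_frame// inner_frame => /rowP/(_ m).
rewrite row_entry => ->; rewrite !mx_entryE; congr (_ + _ - _ * _).
- by rewrite mxE eqxx eq_sym.
- by rewrite mxE eqxx eq_sym.
- by rewrite mxE; apply: eq_bigr => p _; rewrite mxE.
Qed.

Lemma differentiable_lieG x : U x -> differentiable lieG x.
Proof.
move=> Ux; pose L y := \sum_p xi_coord y p *: partial p G y
  + dxi y *m G y + G y *m (dxi y)^T.
have dB := differentiable_dxi Ux; have dG := differentiable_metric Ux.
apply: (@near_eq_differentiable _ _ _ L).
  apply: filterS (open_nbhs_nbhs (conj oU Ux)) => y Uy.
  rewrite /lieG /lie_gram /L; congr (_ + _ + _).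
  by apply: eq_bigr => p _; rewrite partial_metric.
apply: differentiable_add; last first.
  by apply: differentiable_mulmx => //; exact: differentiable_trmx.
apply: differentiable_add; last exact: differentiable_mulmx.
apply: differentiable_sum_fun => p; apply: differentiable_scalemx.
  exact: differentiable_xi_coord.
exact: (Ck_differentiable (Ck_partial p (G_smooth 1)) Ux).
Qed.

Lemma dric_soliton x k j l : U x -> dric (A x) (dconn x) (ddconn x) k j l =
  (lambda *: partial k G x - 2^-1 *: partial k lieG x) j l.
Proof.
move=> Ux; rewrite -partial_ric//.
have dG := differentiable_metric Ux; have dL := differentiable_lieG Ux.
transitivity (partial k (fun y => (lambda *: G y - 2^-1 *: lieG y) j l) x).
  by apply: (open_eq_partial _ oU _ Ux) => y Uy; exact: ric_soliton.
have dZ c (X : V -> 'M[R]_n) : differentiable X x ->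
    differentiable (fun y => c *: X y) x by move=> dX; exact: differentiableZ.
rewrite -partial_mx; last by apply: differentiable_sub; exact: dZ.
by rewrite partial_sub ?partial_cscale//; exact: dZ.
Qed.

(** By the soliton equation the Ricci tensor is lambda g - (1/2) L_xi g, and
    nabla (L_xi g) is known from the conformal equation. *)
Lemma nabla_ric_soliton x k j l : U x ->
  nabla_ric (A x) (dconn x) (ddconn x) k j l = - partial k r x * G x j l.
Proof.
move=> Ux; have H2 : (2^-1 : R) *+ 2 = 1 by field.
have := nabla_soliton_ric lambda H2 (G_sym Ux) (G_unit Ux)
  (fun b m => lie_conn_conformal k b m Ux).
rewrite -/(lieG x) -ricM_soliton// -partial_metric// -partial_lieG//.
move=> /matrixP/(_ j l); rewrite [RHS]mx_entryZ => <-.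
rewrite /nabla_ric dric_soliton//.
rewrite [RHS]mx_entryD [X in _ = X + _]mx_entryD !mx_entryN.
congr (_ - _ - _).
- by rewrite mxE; apply: eq_bigr => p _; rewrite [ricM x _ _]mxE.
- by rewrite mxE; apply: eq_bigr => p _; rewrite [ricM x _ _]mxE [_^T _ _]mxE mulrC.
Qed.

(** The contracted Bianchi identity gives n d_k rho = 2 d_k rho, and n > 2. *)
Lemma soliton_partial_eq0 x k : (2 < n)%N -> U x -> partial k r x = 0.
Proof.
move=> n2 Ux.
have := contracted_bianchi (A := A x) (A1 := dconn x) (A2 := ddconn x)
  (fun l k i => @ddconnC x l k i Ux) (fun i j k => @conn_torsion_free x i j k Ux)
  (G_sym Ux) (G_unit Ux) (fun i j => @curvature_skew i j x Ux)
  (fun k i j => @dcurvature_skew k i j x Ux)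
  (fun k j l => @nabla_ric_soliton x k j l Ux) k.
move=> /eqP; rewrite -subr_eq0 -mulrnBr ?(ltnW n2)// mulrn_eq0 subn_eq0.
by rewrite leqNgt n2 => /eqP.
Qed.

End LocalComputation.

(** * Smooth bump functions *)

Section Flat.
Variable R : realType.
Implicit Types (t : R) (m : nat).

(** The functions t^(-m) exp(-1/t), extended by 0 to t <= 0: a family whose
    linear span is stable under differentiation, so that all of them are
    smooth. *)
Definition flat m t : R := if 0 < t then (t ^+ m)^-1 * expR (- t^-1) else 0.

Lemma flat_le0 m t : t <= 0 -> flat m t = 0.
Proof. by rewrite /flat leNgt => /negbTE ->. Qed.

Lemma flat_gt0 m t : 0 < t -> flat m t = (t ^+ m)^-1 * expR (- t^-1).
Proof. by rewrite /flat => ->. Qed.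

Lemma flat_ge0 m t : 0 <= flat m t.
Proof.
rewrite /flat; case: ifP => // t0.
by rewrite mulr_ge0 ?expR_ge0// invr_ge0 exprn_ge0// ltW.
Qed.

(** A quadratic bound gives derivative 0 at the origin; the exponential series
    bounds exp(1/t) below by its term of degree m + 2. *)
Lemma flat_quadratic m t : `|flat m t| <= (m.+2)`!%:R * t ^+ 2.
Proof.
rewrite ger0_norm ?flat_ge0//; have [t0|t0] := leP t 0.
  by rewrite flat_le0// mulr_ge0// sqr_ge0.
rewrite flat_gt0// expRN.
have u0 : 0 < t^-1 by rewrite invr_gt0.
have fg : 0 < (m.+2)`!%:R :> R by rewrite ltr0n fact_gt0.
have E : (expR t^-1)^-1 <= (m.+2)`!%:R * t ^+ m.+2.
  have := @expR_ge1Dxn R t^-1 m.+1 (ltW u0) => H.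
  rewrite -[leRHS]invrK lef_pV2 ?posrE ?invr_gt0 ?expR_gt0//; last first.
    by rewrite mulr_gt0 ?exprn_gt0.
  rewrite (le_trans _ H)// ler_wpDl// invfM -exprVn mulrC.
  by [].
apply: le_trans (ler_wpM2l _ E) _; first by rewrite invr_ge0 exprn_ge0// ltW.
rewrite mulrCA -addn2 exprD mulKf// expf_neq0// gt_eqF//.
Qed.

Lemma is_derive_quadratic (f : R -> R) C : (forall t, `|f t| <= C * t ^+ 2) ->
  is_derive 0 (1 : R) f 0.
Proof.
move=> fC; have C0 : 0 <= C.
  by have := fC 1; rewrite expr1n mulr1; exact: le_trans.
have f0 : f 0 = 0.
  by have := fC 0; rewrite expr0n/= mulr0 normr_le0 => /eqP.
have H : (fun h : R => h^-1 *: ((f \o shift 0) (h *: 1) - f 0)) @ 0^' --> (0 : R).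
  apply/cvgrPdist_le => e e0; near=> h.
  have h0 : h != 0 by near: h; exact: nbhs_dnbhs_neq.
  rewrite /= f0 subr0 addr0 sub0r normrN [h *: 1]mulr1 normrZ normfV.
  rewrite ler_pdivrMl ?normr_gt0//; apply: le_trans (fC h) _.
  rewrite -real_normK ?num_real// expr2 mulrA mulrC ler_wpM2l//.
  have : `|h| <= e / (C + 1).
    near: h; apply: dnbhs0_le; rewrite divr_gt0// ltr_wpDl//.
  rewrite ler_pdivlMr ?ltr_wpDl// => /(le_trans _); apply.
  by rewrite mulrC ler_wpM2l// lerDl.
by split; [apply/cvg_ex; exists 0|exact/cvg_lim].
Unshelve. all: by end_near. Qed.

Lemma is_derive_flat m t :
  is_derive t (1 : R) (flat m) (flat m.+2 t - m%:R * flat m.+1 t).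
Proof.
have [t0|t0|->] := ltgtP t 0.
- rewrite !flat_le0 ?ltW// mulr0 subr0.
  apply: (@near_eq_is_derive _ _ _ (cst 0)).
  by near=> s; rewrite flat_le0// ltW//; near: s; exact: lt_nbhsl.
- rewrite !flat_gt0//.
  pose F (s : R) : R := (s ^+ m)^-1 * expR (- s^-1).
  have FE : \forall s \near t, F s = flat m s.
    near=> s; rewrite flat_gt0//; near: s; exact: lt_nbhsr.
  apply: (near_eq_is_derive FE).
  pose i (s : R) := s^-1.
  have di : is_derive t (1 : R) i (- t ^- 2 *: 1).
    by apply: (@is_deriveV R id); rewrite ?gt_eqF//; exact: is_derive_id.
  have de : is_derive t (1 : R) (expR \o (- i)) (expR (- t^-1) * (- (- t ^- 2 *: 1))).
    exact: is_derive1_comp.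
  have dX : is_derive t (1 : R) (i ^+ m) ((m%:R * i t ^+ m.-1) *: (- t ^- 2 *: 1)).
    exact: is_deriveX.
  have -> : F = (i ^+ m) * (expR \o (- i)).
    by apply/funext => s; rewrite /F -exprVn fctE exprfctE.
  apply: is_derive_eq (is_deriveM dX de) _.
  rewrite exprfctE /= !fctE /i -!exprVn; move: (t^-1) (expR _) => u E.
  rewrite /GRing.scale/=; case: m @F FE dX => [|m] F FE dX; first by rewrite /=; ring.
  by rewrite /= !exprS; ring.
- rewrite !flat_le0// mulr0 subr0.
  exact: is_derive_quadratic (flat_quadratic m).
Unshelve. all: by end_near. Qed.

Lemma flat0_mono : {homo flat 0 : s t / s <= t}.
Proof.
move=> s t st; have [s0|s0] := leP s 0; first by rewrite flat_le0 ?flat_ge0.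
rewrite !flat_gt0 ?(lt_le_trans s0)// !expr0 invr1 !mul1r ler_expR lerN2.
by rewrite lef_pV2// ?posrE// (lt_le_trans s0).
Qed.

Lemma flat0_gt0 t : 0 < t -> 0 < flat 0 t.
Proof. by move=> t0; rewrite flat_gt0// expr0 invr1 mul1r expR_gt0. Qed.

End Flat.

Section Bump.
Variables (R : realType) (n : nat).
Local Notation V := 'rV[R]_n.

(** Induction on k for all m at once, since differentiating [flat m] involves
    [flat m.+1] and [flat m.+2]. *)
Lemma Ck_flat k m (U : set V) (q : V -> R) : open U -> Ck k U q ->
  Ck k U (fun x => flat m (q x)).
Proof.
move=> oU; elim: k m => [|k IH] m Cq.
  split=> // x Ux; apply: (@differentiable_comp _ _ _ _ q (flat m)).
    exact: (Ck_differentiable Cq Ux).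
  by apply/derivable1_diffP; have [] := is_derive_flat m (q x).
have dq x : U x -> differentiable q x by exact: Ck_differentiable Cq.
have df t : differentiable (@flat R m) t.
  by apply/derivable1_diffP; have [] := is_derive_flat m t.
split.
  by move=> x Ux; apply: (@differentiable_comp _ _ _ _ q (flat m)) => //; exact: dq.
move=> i; have Cf m' := IH m' (CkW Cq).
apply: eq_Ck (CkM oU (CkB oU (Cf m.+2)
  (CkM oU (Ck_cst k U (m%:R : R)) (Cf m.+1))) (Ck_partial i Cq)) => // x Ux.
rewrite [RHS](@partialE _ _ _ (flat m \o q)); last first.
  by apply: differentiable_comp => //; exact: dq.
rewrite diff_comp//=; last exact: dq.
rewrite -partialE; last exact: dq.
rewrite -[X in 'd _ _ X]mulr1 [LHS]mulrC.
have -> : 'd (flat m) (q x) (partial i q x * 1) =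
  partial i q x * 'd (@flat R m) (q x) 1.
  by rewrite -[partial i q x * 1]/(partial i q x *: 1) linearZ.
rewrite -deriveE//; congr (_ * _).
by have [_ ->] := is_derive_flat m (q x).
Qed.

Lemma Ck_coord k (U : set V) i : Ck k U (fun x : V => x 0 i).
Proof.
have dc x : differentiable (fun x : V => x 0 i) x by exact: differentiable_coord.
case: k => [|k]; split=> // a.
have -> : partial a (fun x : V => x 0 i) = fun=> (delta_mx 0 a : V) 0 i.
  apply/funext => x; rewrite -(@partial_mx _ _ _ _ id) /partial ?derive_id//.
exact: Ck_cst.
Qed.

(** Write F = [flat 0] and let q be a multiple of the squared Euclidean distance
    to x0.  Then F (q - 1) vanishes for q <= 1 and is at least a = F 1 for
    q >= 2, so F (a - F (q - 1)) is constant for q <= 1 and vanishes for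
    q >= 2. *)
Lemma exists_bump (x0 : V) (d : R) : 0 < d -> exists phi : V -> R,
  [/\ forall k, Ck k setT phi, \forall x \near x0, phi x = 1 &
      forall x, d <= `|x - x0| -> phi x = 0].
Proof.
move=> d0; pose a := @flat R 0 1; have a0 : 0 < a by exact: flat0_gt0.
(* scaled so that q >= 2 as soon as one coordinate differs by d *)
pose q (x : V) : R := \sum_i (x 0 i - x0 0 i) * (x 0 i - x0 0 i) * (2 / d ^+ 2).
have Cq k : Ck k setT q.
  have oT : open [set: V] by exact: openT.
  have Cid i : Ck k setT (fun x : V => x 0 i - x0 0 i).
    by apply: (CkB oT); [exact: Ck_coord|exact: Ck_cst].
  by apply: (Ck_sum oT) => i; do 2![apply: (CkM oT) => //]; exact: Ck_cst.
exists (fun x => flat 0 (a - flat 0 (q x - 1)) / flat 0 a); split.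
- move=> k; have oT : open [set: V] by exact: openT.
  apply: (CkM oT); last exact: Ck_cst.
  apply: Ck_flat => //; apply: (CkB oT); first exact: Ck_cst.
  by apply: Ck_flat => //; apply: (CkB oT); [exact: Cq|exact: Ck_cst].
- have cq : {for x0, continuous q}.
    by apply: differentiable_continuous; exact: (Ck_differentiable (Cq 0)).
  have q0 : q x0 = 0 by rewrite /q big1// => i _; rewrite subrr !mul0r.
  have : \forall x \near x0, q x < 1.
    by have := cvgr_lt _ cq; rewrite q0; apply; exact: ltr01.
  apply: filterS => x qx; have -> : flat 0 (q x - 1) = 0.
    by rewrite flat_le0// subr_le0 ltW.
  by rewrite subr0 divff// gt_eqF// flat0_gt0.
- move=> x dx; rewrite [X in X / _]flat_le0 ?mul0r// subr_le0; apply: flat0_mono.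
  rewrite lerBrDr; have [i di] : exists i, d <= `|x 0 i - x0 0 i|.
    apply: contrapT => /forallNP H; move: dx; apply/negP; rewrite -ltNge.
    rewrite [ltLHS]/Num.Def.normr/= mx_normrE; apply/bigmax_ltP; split=> // -[j i] _ /=.
    by rewrite (ord1 j) !mxE; have := H i; move/negP; rewrite -ltNge.
  rewrite /q (bigD1 i)//= ler_wpDr//.
    by rewrite sumr_ge0// => j _; rewrite mulr_ge0 ?divr_ge0 ?sqr_ge0// -expr2 sqr_ge0.
  rewrite -expr2 -real_normK ?num_real// mulrA ler_pdivlMr ?exprn_gt0//.
  have : d ^+ 2 <= `|x 0 i - x0 0 i| ^+ 2 by rewrite lerXn2r// nnegrE// ltW.
  by move: (_ ^+ 2) (_ ^+ 2) => a1 b1; lra.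
Qed.

End Bump.

(** * Changes of charts *)

Section Charts.
Variables (R : realType) (n : nat) (M : topologicalType).
Local Notation V := 'rV[R]_n.
Implicit Types c d : chart R n M.

Lemma overlapP c d x : overlap c d x <->
  (chart_map c @` chart_dom c) x /\ chart_dom d (chart_inv c x).
Proof.
split=> [[p [cp dp] <-]|[[p cp <-]]].
  by rewrite chart_mapK//; split=> //; exists p.
by rewrite chart_mapK// => dp; exists p.
Qed.

Lemma chart_inv_cvg c x : (chart_map c @` chart_dom c) x ->
  {for x, continuous (chart_inv c)}.
Proof.
move=> cx; have := @chart_inv_continuous _ _ _ c.
rewrite continuous_open_subspace; last exact: chart_img_open.
by move=> H; apply: H; rewrite inE.
Qed.

Lemma chart_inv_preim_open c (D : set M) : open D ->
  open ((chart_map c @` chart_dom c) `&` chart_inv c @^-1` D).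
Proof.
move=> oD; rewrite openE => x [cx Dx]; apply: filterI.
  by apply: open_nbhs_nbhs; split=> //; exact: chart_img_open.
by apply: (chart_inv_cvg cx); exact: open_nbhs_nbhs.
Qed.

Lemma overlap_open c d : open (overlap c d).
Proof.
rewrite (_ : overlap c d =
  (chart_map c @` chart_dom c) `&` chart_inv c @^-1` chart_dom d).
  exact/chart_inv_preim_open/chart_dom_open.
by apply/seteqP; split=> x /overlapP.
Qed.

Lemma chart_inv_dom c x : (chart_map c @` chart_dom c) x ->
  chart_dom c (chart_inv c x).
Proof. by move=> [p cp <-]; rewrite chart_mapK. Qed.

Lemma chart_invK c x : (chart_map c @` chart_dom c) x ->
  chart_map c (chart_inv c x) = x.
Proof. by move=> [p cp <-]; rewrite chart_mapK. Qed.

Lemma overlap_img c d x : overlap c d x -> (chart_map c @` chart_dom c) x.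
Proof. by move/overlapP => []. Qed.

Lemma chart_inv_transition c d x : overlap c d x ->
  chart_inv d (transition c d x) = chart_inv c x.
Proof. by move=> /overlapP[_ dx]; rewrite /transition/= chart_mapK. Qed.

Lemma transition_overlap c d e x : overlap c d x -> overlap c e x ->
  overlap d e (transition c d x).
Proof.
move=> cd ce; apply/overlapP; rewrite chart_inv_transition//.
split; last by case/overlapP: ce.
by exists (chart_inv c x) => //; case/overlapP: cd.
Qed.

Lemma transition_overlapC c d x : overlap c d x ->
  overlap d c (transition c d x).
Proof.
move=> cd; apply: transition_overlap => //; apply/overlapP.
by have cx := overlap_img cd; split=> //; exact: chart_inv_dom.
Qed.

Lemma transition_comp c d e x : overlap c d x ->
  transition d e (transition c d x) = transition c e x.
Proof.
move=> cd; rewrite {1}/transition/= chart_inv_transition//.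
Qed.

Lemma transition_id c x : (chart_map c @` chart_dom c) x ->
  transition c c x = x.
Proof. by move=> cx; rewrite /transition/= chart_invK. Qed.

End Charts.

(** Chain rule for a function that is a composite only near the point, which is
    how the transition maps of three charts are related. *)
Lemma diff_near_comp (R : realType) (U V W : normedModType R) (f : U -> V)
    (g : V -> W) (h : U -> W) x w :
  (\forall y \near x, g (f y) = h y) -> differentiable f x ->
  differentiable g (f x) -> 'd h x w = 'd g (f x) ('d f x w).
Proof.
move=> gfh df dg; have dgf : differentiable (g \o f) x.
  exact: differentiable_comp.
have /(congr1 (fun F : U -> W => F w)) <- := near_eq_diff gfh dgf.
by rewrite diff_comp.
Qed.

(** * Extending coordinate fields to global vector fields *)

Section Extension.
Variables (R : realType) (n : nat) (M : smooth_manifold R n).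
Local Notation V := 'rV[R]_n.
Implicit Types i j a b : atlas_index M.
Local Notation tau i j := (transition (atlas i) (atlas j)).
Local Notation ovl i j := (overlap (atlas i) (atlas j)).

Lemma transition_Ck i j k : Ck k (ovl i j) (tau i j).
Proof. by move: k; apply/smooth_onP; exact: atlas_compatible. Qed.

Lemma differentiable_transition i j x : ovl i j x -> differentiable (tau i j) x.
Proof. exact: Ck_differentiable (transition_Ck i j 0). Qed.

Lemma diff_transition_comp i a b x y w : ovl i a x -> ovl i b x ->
  tau i a x = y -> 'd (tau i b) x w = 'd (tau a b) y ('d (tau i a) x w).
Proof.
move=> ia ib <-{y}; have dia := differentiable_transition ia.
have dab := differentiable_transition (transition_overlap ia ib).
apply: diff_near_comp dia dab.
have oia := @overlap_open _ _ _ (atlas i) (atlas a).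
apply: filterS (open_nbhs_nbhs (conj oia ia)) => y iay.
exact: transition_comp.
Qed.

Variables (i : atlas_index M) (phi : V -> R) (B : set V) (v : V).

(** Expression in the chart j of the field equal to phi v in the chart i and to 0
    outside the domain of the chart i. *)
Definition spread j (y : V) : V :=
  if `[< ovl j i y >] then 'd (tau i j) (tau j i y) (phi (tau j i y) *: v)
  else 0.

Lemma spread_in j y : ovl j i y ->
  spread j y = 'd (tau i j) (tau j i y) (phi (tau j i y) *: v).
Proof. by move=> H; rewrite /spread asboolT. Qed.

Lemma spread_out j y : ~ ovl j i y -> spread j y = 0.
Proof. by move=> H; rewrite /spread asboolF. Qed.

Hypothesis phi_smooth : forall k, Ck k setT phi.
Hypothesis phi_supp : forall x, ~ B x -> phi x = 0.
Hypothesis B_compact : compact B.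
Hypothesis B_sub : B `<=` chart_image i.

(** The image of the support is compact, hence closed because the manifold is
    Hausdorff. *)
Lemma image_support_closed : closed (chart_inv (atlas i) @` B).
Proof.
apply: compact_closed; first exact: carrier_hausdorff.
apply: continuous_compact => //.
apply: continuous_subspaceW B_sub _; exact: chart_inv_continuous.
Qed.

Lemma spread_Ck_overlap j k : Ck k (ovl j i) (spread j).
Proof.
have oji := @overlap_open _ _ _ (atlas j) (atlas i).
apply/Ck_mxP => // r b.
have H x : ovl j i x -> ovl i j (tau j i x) by exact: transition_overlapC.
have Cp : Ck k (ovl j i) (phi \o tau j i).
  by apply: (Ck_comp oji (U' := setT)) => //; exact: transition_Ck.
have Ca q : Ck k (ovl j i) ((fun z => partial q (tau i j) z r b) \o tau j i).
  apply: (Ck_comp oji H) => //; first exact: transition_Ck.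
  have := Ck_partial q (transition_Ck i j k.+1).
  by move/(Ck_mxP _ _ (@overlap_open _ _ _ (atlas i) (atlas j))); apply.
apply: eq_Ck (CkM oji Cp (Ck_sum oji (index_enum 'I_n) xpredT
  (fun q => CkM oji (Ck_cst k _ (v 0 q)) (Ca q)))) => // x jix.
rewrite spread_in// linearZ mxE; congr (_ * _).
rewrite diff_partial; last exact/differentiable_transition/H.
by rewrite summxE; apply: eq_bigr => q _; rewrite mxE.
Qed.

(** A point outside the domain of the chart i is outside the closed image of the
    support of phi, so the field vanishes near it. *)
Lemma spread_Ck j k : Ck k (chart_image j) (spread j).
Proof.
apply: Ck_local => x jx; have [ji|nji] := pselect (ovl j i x).
  by exists (ovl j i) => //; exact: spread_Ck_overlap.
pose K := chart_inv (atlas i) @` B.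
exists (chart_image j `&` chart_inv (atlas j) @^-1` (~` K)).
  split=> // -[z Bz zx]; apply: nji; apply/overlapP; split=> //.
  by rewrite -zx; apply: chart_inv_dom; exact: B_sub.
apply: eq_Ck (Ck_cst k _ (0 : V)).
  exact/chart_inv_preim_open/closed_openC/image_support_closed.
move=> y [jy Ky]; have [ji|nji'] := pselect (ovl j i y); last by rewrite spread_out.
rewrite spread_in// phi_supp ?scale0r ?linear0// => By; apply: Ky.
by exists (tau j i y) => //; exact: chart_inv_transition.
Qed.

End Extension.

Section ConstantExtension.
Variables (R : realType) (n : nat) (M : smooth_manifold R n).
Local Notation V := 'rV[R]_n.

(** Provides enough global vector fields to read tensor equations between global
    fields as equations between their components in a chart. *)
Lemma extend_constant (i : atlas_index M) (x0 v : V) : chart_image i x0 ->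
  exists X : vector_field M, same_germ (X i) (fun=> v) x0.
Proof.
move=> ix0.
have oi : open (chart_image i) by exact: chart_img_open.
have /nbhs_ballP[d /= d0 Hd] := open_nbhs_nbhs (conj oi ix0).
pose e := d / 2; have e0 : 0 < e by rewrite divr_gt0.
have [phi [phi_smooth phi1 phi0]] := exists_bump x0 e0.
pose B : set V := [set x | `|x0 - x| <= e].
have BE : B = closed_ball x0 e by rewrite closed_ballE.
have phi_supp x : ~ B x -> phi x = 0.
  by move=> Bx; apply: phi0; rewrite distrC; move/negP: Bx; rewrite -ltNge => /ltW.
have B_compact : compact B.
  apply: bounded_closed_compact; last by rewrite BE; exact: closed_ball_closed.
  exists (`|x0| + e); split; first exact: num_real.
  move=> N /ltW eN x /= xB; rewrite -[x](subKr x0).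
  by rewrite (le_trans (ler_normB _ _))// (le_trans _ eN)// lerD2l.
have B_sub : B `<=` chart_image i.
  move=> x xB; apply: Hd; rewrite -ball_normE /ball_/=.
  by rewrite (le_lt_trans xB)// /e ltr_pdivrMr// ltr_pMr// ltr1n.
pose F := @spread R n M i phi v.
have F_smooth j : smooth_on (chart_image j) (F j).
  apply/smooth_onP => k.
  exact: (spread_Ck v phi_smooth phi_supp B_compact B_sub).
have F_change a b x : overlap (atlas a) (atlas b) x ->
    let tau := transition (atlas a) (atlas b) in
    F b (tau x) = 'd tau x (F a x).
  move=> ab /=; have [ai|nai] := pselect (overlap (atlas a) (atlas i) x).
    have bi := transition_overlap ab ai.
    rewrite /F (spread_in _ _ ai) (spread_in _ _ bi).
    rewrite (transition_comp _ ab).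
    apply: (diff_transition_comp _ (transition_overlapC ai)).
      exact: transition_overlap.
    rewrite (transition_comp _ ai) transition_id//; exact: overlap_img ab.
  rewrite /F (spread_out _ _ nai) linear0 spread_out// => bi; apply: nai.
  have := transition_overlap (transition_overlapC ab) bi.
  rewrite transition_comp// transition_id//.
  exact: overlap_img ab.
exists (VectorField F_smooth F_change).
have oix : nbhs x0 (chart_image i) by exact: open_nbhs_nbhs.
apply: filterS2 oix phi1 => x ix px /=.
have ii : overlap (atlas i) (atlas i) x.
  by apply/overlapP; split=> //; exact: chart_inv_dom.
rewrite /F spread_in// transition_id// px scale1r.
rewrite -deriveE; last exact: differentiable_transition.
rewrite -(@near_eq_derive _ _ _ id) ?derive_id//.
apply: filterS (open_nbhs_nbhs (conj oi ix)) => y iy.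
by rewrite transition_id.
Qed.

End ConstantExtension.

(** * The soliton theorem *)

(** The conformal function of an affine conformal Killing potential is locally
    constant in dimension n > 2. *)
Lemma soliton_potential_constant (R : realType) (n : nat)
    (M : smooth_manifold R n) (g : riemannian_metric M) (xi : vector_field M)
    (lambda : R) (rho : M -> R) : (2 < n)%N ->
  ricci_soliton g xi lambda -> smooth_function rho ->
  (forall (X Y : vector_field M) i x, chart_image i x ->
    let r := local_expr rho i in
    lie_connection (g i) (xi i) (X i) (Y i) x =
      'D_(X i x) r x *: Y i x + 'D_(Y i x) r x *: X i x
      - inner (g i) (X i) (Y i) x *: gradient (g i) r x) ->
  forall i x k, chart_image i x -> partial k (local_expr rho i) x = 0.
Proof.
move=> n2 sol srho conf i x k ix.
have oi : open (chart_image i) by exact: chart_img_open.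
have gS : forall k, Ck k (chart_image i) (g i) by apply/smooth_onP/gram_smooth.
have xS : forall k, Ck k (chart_image i) (xi i) by apply/smooth_onP/vf_smooth.
apply: (soliton_partial_eq0 oi gS (@gram_sym _ _ _ g i) (@gram_posdef _ _ _ g i)
  xS (lambda := lambda) (r := local_expr rho i)) ix => //.
- move=> a b y iy.
  have [X XE] := extend_constant (delta_mx 0 a) iy.
  have [Y YE] := extend_constant (delta_mx 0 b) iy.
  have := sol X Y i y iy.
  by rewrite (lie_metric_germ _ _ XE YE) (ricci_germ _ XE YE)
    (same_germ_at (inner_germ _ XE YE)).
- move=> a b y iy.
  have [X XE] := extend_constant (delta_mx 0 a) iy.
  have [Y YE] := extend_constant (delta_mx 0 b) iy.
  have /= := conf X Y i y iy.
  by rewrite (lie_connection_germ _ _ XE YE) (same_germ_at (inner_germ _ XE YE))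
    (same_germ_at XE) (same_germ_at YE).
Qed.

Theorem proposition4p2 (R : realType) (n : nat) (n_gt2 : (2 < n)%N) :
  ~ exists (M : smooth_manifold R n) (g : riemannian_metric M)
           (xi : vector_field M) (lambda : R),
      [/\ connected [set: M]%classic, nontrivial_soliton g xi lambda,
          affine_conformal_killing g xi & ~ affine_killing g xi].
Proof.
move=> [M [g [xi [lambda [_ [sol _] [rho srho conf] nak]]]]]; apply: nak.
have drho := soliton_potential_constant n_gt2 sol srho conf.
move=> X Y i x ix; rewrite conf//.
have dr : differentiable (local_expr rho i) x.
  by apply: (@Ck_differentiable _ _ _ 0 (chart_image i)) => //;
    move: 0%N; apply/smooth_onP.
have D0 v : 'D_v (local_expr rho i) x = 0.
  by rewrite derive_partial// big1// => a _; rewrite drho// scaler0.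
have -> : gradient (g i) (local_expr rho i) x = 0.
  rewrite /gradient (_ : \row_i0 _ = 0) ?mul0mx//.
  by apply/rowP => a; rewrite !mxE D0.
by rewrite !D0 !scale0r scaler0 addr0 subr0.
Qed.
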